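(* Let $\rho>0$, let $\{a_i\}_{i\in\mathbb{N}}$ be a sequence of positive numbers with $\sum_{i=1}^\infty a_i=1$, and let $\{z_i\}_{i\in\mathbb{N}}$ be a sequence of distinct real numbers with $|z_i|<\rho$ for all $i\in\mathbb{N}$ and $\lim_{i\to\infty}z_i=\rho$. Then the function $f(z)=\sum_{i=1}^\infty\frac{a_i}{z-z_i}$, which is meromorphic in the disk $\mathbb{D}(\rho)=\{z\in\mathbb{C}:|z|<\rho\}$, has an infinite discrete set of real zeros $\{w_j\}_{j\in\mathbb{N}}$, and the sequences $\{z_i\}_{i\in\mathbb{N}}$ and $\{w_j\}_{j\in\mathbb{N}}$ interlace on the real axis. Moreover, there exists an infinite matrix $S=(s_{ij})_{i,j=1}^\infty$ such that for all $(i,j)\in\mathbb{N}^2$ one has $$s_{ij}\ge 0,\qquad\sum_{k=1}^\infty s_{ik}=1,\qquad\sum_{l=1}^\infty s_{lj}=1-a_j,\qquad w_i=\sum_{k=1}^\infty s_{ik}z_k.$$ In particular, for any $\lambda\in\mathbb{C}\setminus\{0\}$ and $\mu\in\mathbb{C}$ the inequality $$\sum_{j=1}^\infty\Phi(\lambda w_j+\mu)\le\sum_{i=1}^\infty(1-a_i)\,\Phi(\lambda z_i+\mu)$$ holds for any convex function $\Phi:\mathbb{C}\to\mathbb{R}$.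
   Context: $\mathbb{C}$ is identified with $\mathbb{R}^2$ when speaking of convex functions. The points $z_i$ are thought of as particles carrying charges $a_i$; $f$ is (up to conjugation and a constant factor) the resulting electrostatic force, and its zeros are the equilibrium points. *)

(* Defs.v *)
From HB Require Import structures.
From mathcomp Require Import all_boot all_order all_algebra.
From mathcomp Require Import complex.
From mathcomp Require Import all_classical all_reals all_analysis.

Set Implicit Arguments.
Unset Strict Implicit.
Unset Printing Implicit Defensive.

Import Order.TTheory GRing.Theory Num.Theory.
Import numFieldNormedType.Exports.

Local Open Scope classical_set_scope.
Local Open Scope complex_scope.
Local Open Scope ring_scope.

(* The topology of R[i] is the one of its norm; derivatives on R[i] are
   complex derivatives, since the field of scalars is R[i] itself. *)
HB.instance Definition _ (R : realType) := NormedModule.copy R[i] R[i]^o.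

Definition disk (R : realType) (rho : R) : set R[i] :=
  [set z | `|z| < rho%:C].

Definition holomorphic_at (R : realType) (f : R[i] -> R[i]) (z : R[i]) : Prop :=
  \forall u \near z, derivable f u 1.

(* The value f p itself, arbitrary for a total function, plays no role. *)
Definition pole (R : realType) (f : R[i] -> R[i]) (p : R[i]) : Prop :=
  (\forall u \near p^', holomorphic_at f u) /\ `|f u| @[u --> p^'] --> +oo.

(* Holomorphic except for poles; these are isolated and do not accumulate
   inside D by the definition of a pole. *)
Definition meromorphic_on (R : realType) (D : set R[i]) (f : R[i] -> R[i])
    : Prop :=
  forall z, D z -> holomorphic_at f z \/ pole f z.

(* Holomorphy excludes a pole at which the total function happens to be 0. *)
Definition zero_of (R : realType) (f : R[i] -> R[i]) (w : R[i]) : Prop :=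
  holomorphic_at f w /\ f w = 0.

Definition force (R : realType) (a z : nat -> R) (x : R[i]) (i : nat) : R[i] :=
  (a i)%:C / (x - (z i)%:C).

Definition total_force (R : realType) (a z : nat -> R) (x : R[i]) : R[i] :=
  limn (series (force a z x)).

Definition real_zeros (R : realType) (D : set R[i]) (f : R[i] -> R[i])
    : set R :=
  [set x : R | D x%:C /\ zero_of f x%:C].

(* Neither sequence is assumed to be monotone: u and v interlace when their
   increasing rearrangements satisfy u_0 < v_0 < u_1 < v_1 < ... *)
Definition interlace (R : realType) (u v : nat -> R) : Prop :=
  exists s t : nat -> nat, [/\ bijective s, bijective t &
    forall k, u (s k) < v (t k) < u (s k.+1)].

(* Main.v *)
Require Import Defs.
From HB Require Import structures.
From mathcomp Require Import all_boot all_order all_algebra.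
From mathcomp Require Import complex.
From mathcomp Require Import all_classical all_reals all_analysis.
From mathcomp Require Import ring lra zify.

Set Implicit Arguments.
Unset Strict Implicit.
Unset Printing Implicit Defensive.

Import Order.TTheory GRing.Theory Num.Theory.
Import numFieldNormedType.Exports.

Local Open Scope classical_set_scope.
Local Open Scope complex_scope.
Local Open Scope ring_scope.

(* Write <g, h> = sum_k a_k g(z_k) h(z_k).  After sorting the z_k increasingly,
   f decreases from +oo to -oo on every gap between consecutive points, so it
   has exactly one zero w_i there and no other real zero.  The functions
   phi_i(x) = 1 / (x - w_i) are orthogonal to 1, since <phi_i, 1> = - f(w_i),
   and to each other, since phi_i phi_l is a multiple of phi_i - phi_l.  With
   1 / c_i = <phi_i, phi_i>, put s_ij = c_i a_j phi_i(z_j)^2.  The row identities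
   are <phi_i, phi_i> = 1 / c_i and <phi_i, 1> = 0, while the column identity
   says that 1 and the phi_i form a complete system.  Completeness is explicit:
   the rational function prod_i (x - y_i) / (x - w_i), with y_i running over the
   N + 1 smallest points except z_j, lies in the span of 1, phi_0, ...,
   phi_(N-1); it vanishes at those points, is at least 1 at z_j by interlacing,
   and is bounded, uniformly in N, at the remaining points, whose total charge
   tends to 0.

   The convex inequality follows from Jensen's inequality along each row and an
   exchange of summations, which is legitimate because a convex function has
   constant sign on some interval [x, rho). *)

(** * Sums against nonnegative weights *)

Section WeightedMean.
Context {R : realType}.
Implicit Types (a g h : nat -> R) (m n c : R).

(** A relation carries convergence and value together, so no default limit can intervene. The total
    weight is left free: besides the charges, the weights may be a row of the matrix or a finite sum
    of rows. *)
Definition has_mean a g m := series (fun k => a k * g k) @ \oo --> m.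

Lemma has_mean_ext a g h m : g =1 h -> has_mean a g m -> has_mean a h m.
Proof. by move=> /funext ->. Qed.
Arguments has_mean_ext {a} g {h m}.

Lemma has_meanD a g h m n : has_mean a g m -> has_mean a h n ->
  has_mean a (fun k => g k + h k) (m + n).
Proof.
move=> gm hn; rewrite /has_mean.
rewrite (_ : series _ = series (fun k => a k * g k)
  \+ series (fun k => a k * h k)); first exact: cvgD.
apply/funext => N; rewrite /series /= -big_split.
by apply: eq_bigr => i _; rewrite mulrDr.
Qed.

Lemma has_meanZ a g m c : has_mean a g m -> has_mean a (fun k => c * g k) (c * m).
Proof.
move=> gm; rewrite /has_mean.
rewrite (_ : series _ = fun N => c * series (fun k => a k * g k) N).
  by apply: cvgM => //; exact: cvg_cst.
apply/funext => N; rewrite /series /= mulr_sumr.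
by apply: eq_bigr => i _; rewrite mulrCA.
Qed.

Arguments has_meanZ {a g m} c.

Lemma has_meanB a g h m n : has_mean a g m -> has_mean a h n ->
  has_mean a (fun k => g k - h k) (m - n).
Proof.
move=> gm /(has_meanZ (-1)) hn; have := has_meanD gm hn.
by rewrite mulN1r; apply: has_mean_ext => k; rewrite mulN1r.
Qed.

Lemma has_mean_sum a (g : nat -> nat -> R) (m : nat -> R) (N : nat) :
  (forall i, (i < N)%N -> has_mean a (g i) (m i)) ->
  has_mean a (fun k => \sum_(i < N) g i k) (\sum_(i < N) m i).
Proof.
elim: N => [|N IHN] gm.
  rewrite big_ord0; apply: (has_mean_ext (fun=> 0)) => [k|].
    by rewrite big_ord0.
  rewrite /has_mean (_ : series _ = cst 0); first exact: cvg_cst.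
  by apply/funext => n; rewrite /series /= big1// => i _; rewrite mulr0.
rewrite big_ord_recr /=.
apply: (has_mean_ext (fun k => \sum_(i < N) g i k + g N k)) => [k|].
  by rewrite big_ord_recr.
by apply: has_meanD; [apply: IHN => i iN; apply: gm; exact: ltnW|exact: gm].
Qed.

Arguments has_mean_sum {a} g m N.

Lemma has_mean_cst a c : series a @ \oo --> (1 : R) -> has_mean a (fun=> c) c.
Proof.
move=> a1; have : has_mean a (fun=> 1) 1.
  by rewrite /has_mean; under eq_fun do rewrite mulr1.
by move/(has_meanZ c); rewrite mulr1.
Qed.

Lemma has_mean_delta a j c : has_mean a (fun k => (k == j)%:R * c) (a j * c).
Proof.
rewrite /has_mean; apply: cvg_near_cst; near=> N.
rewrite /series /= (bigD1_seq j)//= ?iota_uniq// ?mem_index_iota//=; last first.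
  by near: N; exact: nbhs_infty_gt.
rewrite eqxx mul1r big1 ?addr0// => i /negbTE ->.
by rewrite mul0r mulr0.
Unshelve. all: by end_near. Qed.

(** Besides bounding single terms, this yields strict positivity of a mean: a single strictly
    positive term suffices. *)
Lemma has_mean_ge_term a g m j : (forall k, 0 <= a k) -> (forall k, 0 <= g k) ->
  has_mean a g m -> a j * g j <= m.
Proof.
move=> a0 g0 gm.
have nd : nondecreasing_seq (series (fun k => a k * g k)).
  by apply: nondecreasing_series => k _ _; exact: mulr_ge0.
have := nondecreasing_cvgn_le nd (cvgP _ gm) j.+1; rewrite (cvg_lim _ gm)//.
apply: le_trans; rewrite /series /= big_nat_recr //= lerDr.
by apply: sumr_ge0 => i _; exact: mulr_ge0.
Qed.

Lemma has_mean_ge0 a g m : (forall k, 0 <= a k) -> (forall k, 0 <= g k) ->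
  has_mean a g m -> 0 <= m.
Proof.
move=> a0 g0 /(has_mean_ge_term 0%N a0 g0); apply: le_trans.
exact: mulr_ge0.
Qed.

Lemma has_mean_le a g h m n : (forall k, 0 <= a k) -> (forall k, g k <= h k) ->
  has_mean a g m -> has_mean a h n -> m <= n.
Proof.
move=> a0 gh gm hn; rewrite -subr_ge0; apply: has_mean_ge0 (has_meanB hn gm) => //.
by move=> k; rewrite subr_ge0.
Qed.

Lemma bounded_has_mean a g c : (forall k, 0 <= a k) -> cvgn (series a) ->
  (forall k, `|g k| <= c) -> exists m, has_mean a g m.
Proof.
move=> a0 /cvg_ex[l al] gc.
suff : cvgn (series (fun k => a k * g k)) by move=> /cvg_ex.
have /(has_meanZ c)/cvgP al1 : has_mean a (fun=> 1) l.
  by rewrite /has_mean; under eq_fun do rewrite mulr1.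
apply: normed_cvg; apply: series_le_cvg al1 => k /=.
- exact: normr_ge0.
- by rewrite mulr1 mulr_ge0//; exact: le_trans (gc 0%N).
- by rewrite mulr1 normrM (ger0_norm (a0 k)) ler_wpM2l.
Qed.

End WeightedMean.
Arguments has_mean_cst {R a} c.
Arguments has_mean_delta {R} a j c.
Arguments has_mean_ext {R a} g {h m}.
Arguments has_mean_sum {R a} g m N.
Arguments has_meanZ {R a g m} c.
Arguments has_mean_ge_term {R a g m} j.

(** * Bessel's inequality and reproducing kernels of finite orthogonal systems *)

(* [c i] is the inverse of the squared norm of [phi i]. *)
Section Orthogonal.
Context {R : realType}.
Variables (a : nat -> R) (phi : nat -> nat -> R) (c : nat -> R).
Hypothesis a_ge0 : forall k, 0 <= a k.
Hypothesis a_sum : series a @ \oo --> (1 : R).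
Hypothesis c_gt0 : forall i, 0 < c i.
Hypothesis phi_mean : forall i, has_mean a (phi i) 0.
Hypothesis phi_orth : forall i l,
  has_mean a (fun k => phi i k * phi l k) (if i == l then (c i)^-1 else 0).

Definition expansion N (u : R) (b : nat -> R) k :=
  u + \sum_(i < N) b i * phi i k.

Lemma expansion_mean N u b : has_mean a (expansion N u b) u.
Proof.
have h i : (i < N)%N -> has_mean a (fun k => b i * phi i k) (b i * 0).
  by move=> _; exact: has_meanZ.
have := has_meanD (has_mean_cst u a_sum) (has_mean_sum _ _ _ h).
rewrite [\sum_(_ < _) _]big1 ?addr0// => i _; exact: mulr0.
Qed.

Arguments expansion_mean N u b : clear implicits.

Lemma expansion_mean_phi N u b i : (i < N)%N ->
  has_mean a (fun k => phi i k * expansion N u b k) (b i / c i).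
Proof.
move=> iN.
apply: (has_mean_ext (fun k => u * phi i k +
    \sum_(l < N) b l * (phi i k * phi l k))) => [k|].
  rewrite /expansion mulrDr [u * _]mulrC mulr_sumr; congr (_ + _).
  by apply: eq_bigr => l _; rewrite mulrCA.
have h l : (l < N)%N -> has_mean a (fun k => b l * (phi i k * phi l k))
    (b l * (if i == l then (c i)^-1 else 0)).
  by move=> _; exact: has_meanZ.
have := has_meanD (has_meanZ u (phi_mean i)) (has_mean_sum _ _ _ h).
rewrite mulr0 add0r (bigD1 (Ordinal iN))//= eqxx big1 ?addr0// => l /negP li.
by case: eqP => [il|]; rewrite ?mulr0//; case: li; apply/eqP/val_inj.
Qed.

(** Parseval's identity in the span: [1] has norm one because the total charge is [1], and [phi i]
    has squared norm [(c i)^-1]. *)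
Lemma expansion_meanM N u b v d :
  has_mean a (fun k => expansion N u b k * expansion N v d k)
    (u * v + \sum_(i < N) b i * d i / c i).
Proof.
apply: (has_mean_ext (fun k => u * expansion N v d k +
    \sum_(i < N) b i * (phi i k * expansion N v d k))) => [k|].
  rewrite [in RHS]/expansion mulrDl mulr_suml; congr (_ + _).
  by apply: eq_bigr => i _; rewrite mulrA.
have h i : (i < N)%N -> has_mean a
    (fun k => b i * (phi i k * expansion N v d k)) (b i * d i / c i).
  by move=> iN; rewrite -mulrA; apply: has_meanZ; exact: expansion_mean_phi.
exact: has_meanD (has_meanZ u (expansion_mean N v d)) (has_mean_sum _ _ _ h).
Qed.

Arguments expansion_meanM N u b v d : clear implicits.

(** The reproducing kernel on the diagonal. Since [a j * kernel_diag N j] is [a j] plus the partial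
    column sum of the [s_ij], the column identity amounts to its convergence to [1]. *)
Definition kernel_diag N j := 1 + \sum_(i < N) c i * phi i j ^+ 2.

Lemma kernel_diag_ge1 N j : 1 <= kernel_diag N j.
Proof.
by rewrite lerDl sumr_ge0// => i _; rewrite mulr_ge0 ?sqr_ge0 ?ltW.
Qed.

(* [expansion N 1 (fun i => c i * phi i j)] is the reproducing kernel of the
   span at the point [j]. *)
Lemma kernel_reproducing N u b j :
  has_mean a (fun k => expansion N u b k *
    expansion N 1 (fun i => c i * phi i j) k) (expansion N u b j).
Proof.
have := expansion_meanM N u b 1 (fun i => c i * phi i j).
congr (has_mean _ _ _); rewrite mulr1; congr (_ + _); apply: eq_bigr => i _.
by rewrite [c i * _]mulrC mulrA mulfK// gt_eqF.
Qed.

Arguments kernel_reproducing N u b j : clear implicits.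

Lemma kernel_at N j : expansion N 1 (fun i => c i * phi i j) j = kernel_diag N j.
Proof.
by congr (_ + _); apply: eq_bigr => i _; rewrite expr2 mulrA.
Qed.

(** Bessel's inequality for the indicator of [j]: the kernel [H] at [j] satisfies [<H, H> = H j],
    and the single term [a j * H j ^+ 2] is at most [<H, H>]. *)
Lemma kernel_diag_le N j : a j * kernel_diag N j <= 1.
Proof.
set H := expansion N 1 (fun i => c i * phi i j).
have HH : has_mean a (fun k => H k * H k) (kernel_diag N j).
  by rewrite -kernel_at; exact: kernel_reproducing.
have T0 : 0 < kernel_diag N j by rewrite (lt_le_trans ltr01)// kernel_diag_ge1.
have : a j * (kernel_diag N j * kernel_diag N j) <= kernel_diag N j.
  have sq k : 0 <= H k * H k by rewrite -expr2 sqr_ge0.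
  by have := has_mean_ge_term j a_ge0 sq HH; rewrite /H kernel_at.
by rewrite mulrA -[leRHS]mul1r ler_pM2r.
Qed.

(** Cauchy-Schwarz applied to [h j = <h, H>] with [<H, H> = T]. It comes from the nonnegative mean
    of the square of [h - t * H], where [t * H] is the projection of [h] on [H]. *)
Lemma kernel_cauchy_schwarz N u b j m :
  has_mean a (fun k => expansion N u b k ^+ 2) m ->
  expansion N u b j ^+ 2 <= m * kernel_diag N j.
Proof.
set h := expansion N u b; set H := expansion N 1 (fun i => c i * phi i j).
set T := kernel_diag N j => hm.
have T0 : 0 < T by rewrite (lt_le_trans ltr01)// kernel_diag_ge1.
have HH : has_mean a (fun k => H k * H k) T.
  by rewrite /T -kernel_at; exact: kernel_reproducing.
have hH : has_mean a (fun k => h k * H k) (h j) by exact: kernel_reproducing.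
set t := h j / T.
have sq k : 0 <= h k ^+ 2 - 2 * t * (h k * H k) + t ^+ 2 * (H k * H k).
  by rewrite (_ : _ + _ = (h k - t * H k) ^+ 2) ?sqr_ge0//; ring.
have := has_mean_ge0 a_ge0 sq (has_meanD
  (has_meanB hm (has_meanZ (2 * t) hH)) (has_meanZ (t ^+ 2) HH)).
rewrite (_ : _ + _ = m - h j ^+ 2 / T); last by rewrite /t; field; rewrite gt_eqF.
by rewrite subr_ge0 ler_pdivrMr.
Qed.

End Orthogonal.

(** By induction, multiplying by the last factor [1 + d / (x - w N)]; the poles stay simple because
    [w] is injective. *)
Lemma partial_fractions (F : fieldType) (y w : nat -> F) N : injective w ->
  exists b : nat -> F, forall x, (forall i, (i < N)%N -> x != w i) ->
    \prod_(i < N) ((x - y i) / (x - w i)) = 1 + \sum_(i < N) b i / (x - w i).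
Proof.
move=> w_inj; elim: N => [|N [b bE]].
  by exists (fun=> 0) => x _; rewrite !big_ord0 addr0.
pose d := w N - y N.
(* The product of [b i / (x - w i)] and [d / (x - w N)] is [b i * d / (w i - w N)] times the
   difference of the two simple fractions; the parts with pole [w N] are collected in the last
   coefficient. *)
pose b' i := if (i < N)%N then b i * (1 + d / (w i - w N))
  else d - \sum_(l < N) b l * d / (w l - w N).
exists b' => x xw; rewrite !big_ord_recr /= {}bE => [|i iN]; last exact/xw/ltnW.
have xN : x - w N != 0 by rewrite subr_eq0 xw.
rewrite (_ : (x - y N) / (x - w N) = 1 + d / (x - w N)); last by rewrite /d; field.
suff -> : \sum_(i < N) b' i / (x - w i) + b' N / (x - w N) =
    (\sum_(i < N) b i / (x - w i)) * (1 + d / (x - w N)) + d / (x - w N) by ring.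
rewrite {2}/b' ltnn mulrBl !mulr_suml addrCA -sumrB addrC; congr (_ + _).
apply: eq_bigr => i _; rewrite /b' ltn_ord /=.
have xi : x - w i != 0 by rewrite subr_eq0 xw// ltnW//= ltnS ltn_ord.
have wiN : w i - w N != 0.
  by rewrite subr_eq0; apply/eqP => /w_inj /eqP; rewrite ltn_eqF.
by field; rewrite xi wiN xN.
Qed.

(** * Sorting a sequence that accumulates only at its strict upper bound *)

Section Enumeration.
Context {R : realType}.
Implicit Types (z : nat -> R) (rho x : R).

Lemma eventually_above z rho x : z @ \oo --> rho -> x < rho ->
  exists N, forall k, (N <= k)%N -> x < z k.
Proof.
move=> z_lim x_rho; have [N _ zN] : \forall k \near \oo, x < z k.
  exact: cvgr_gt z_lim _ x_rho.
by exists N.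
Qed.

(** The minimum is taken over finitely many indices: some [z M] exceeds [x], and from some rank on
    every point exceeds [z M]. *)
Lemma next_point z rho x : z @ \oo --> rho -> (forall i, z i < rho) ->
  x < rho -> exists i, x < z i /\ forall k, x < z k -> z i <= z k.
Proof.
move=> z_lim z_lt x_rho; have [M zM] := eventually_above z_lim x_rho.
have xM : x < z M by exact: zM.
have [N zN] := eventually_above z_lim (z_lt M).
pose n := maxn N M.
have Mn : (M < n.+1)%N by rewrite ltnS leq_maxr.
case: (@Order.TotalTheory.arg_minP _ _ 'I_n.+1 (Ordinal Mn) (fun i => x < z i)
  (fun i => z i)) => //= i xi imin.
exists i; split=> // k xk; have [kn|nk] := ltnP k n.+1.
  exact: (imin (Ordinal kn)).
apply: le_trans (imin (Ordinal Mn) xM) _; apply/ltW/zN.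
by rewrite (leq_trans _ (ltnW nk))// leq_maxl.
Qed.

Lemma injective_unbounded (s : nat -> nat) N : injective s ->
  exists n, (N <= s n)%N.
Proof.
move=> s_inj; apply: contrapT => /forallNP sN.
have lt n : (s n < N)%N by rewrite ltnNge; apply/negP/sN.
have /leq_card : injective (fun n : 'I_N.+1 => Ordinal (lt n)).
  by move=> m n /(congr1 val) /s_inj /val_inj.
by rewrite !card_ord ltnn.
Qed.

Lemma increasing_ltn z : (forall n, z n < z n.+1) ->
  {homo z : m n / (m < n)%N >-> m < n}.
Proof. by move=> z_incr; apply: homo_ltn => // x y t; exact: lt_trans. Qed.

Lemma increasing_leq z : (forall n, z n < z n.+1) ->
  {homo z : m n / (m <= n)%N >-> m <= n}.
Proof.
by move=> z_incr; apply: homo_leq => // [x y t|n]; [exact: le_trans|exact: ltW].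
Qed.

Lemma increasing_inj z : (forall n, z n < z n.+1) -> injective z.
Proof.
move=> z_incr m n zmn; apply/eqP; case: (ltngtP m n) => // /(increasing_ltn z_incr);
  by rewrite zmn ltxx.
Qed.

(** Greedy enumeration, each time passing to the next larger point. If an index [k] were missed, all
    chosen points would stay below [z k], whereas their distinct indices are unbounded and points of
    large index exceed [z k]. *)
Lemma sorting_bijection z rho : injective z -> (forall i, z i < rho) ->
  z @ \oo --> rho -> exists s, bijective s /\ forall n, z (s n) < z (s n.+1).
Proof.
move=> z_inj z_lt z_lim.
have [x0 x0_lt] : exists x0, forall k, x0 < z k.
  have [N zN] := eventually_above z_lim (z_lt 0%N).
  case: (@Order.TotalTheory.arg_minP _ _ 'I_N.+1 ord0 predT
    (fun i => z i)) => //= i _ imin.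
  exists (z i - 1) => k; rewrite ltrBlDr.
  have [kN|Nk] := ltnP k N.+1.
    by rewrite (le_lt_trans (imin (Ordinal kN) isT))//= ltrDl.
  rewrite (le_lt_trans (imin ord0 isT))//= (lt_trans (zN _ (ltnW Nk)))//.
  by rewrite ltrDl.
(* For [x >= rho] the index [0] is a default, which makes the choice function total. *)
have next x : exists i, x < rho -> x < z i /\ forall k, x < z k -> z i <= z k.
  have [xr|xr] := ltP x rho; last by exists 0%N.
  by have [i ?] := next_point z_lim z_lt xr; exists i.
have {next}[nxt nxtP] := boolp.choice next.
pose s := fix s n := if n is m.+1 then nxt (z (s m)) else nxt x0.
have s_incr n : z (s n) < z (s n.+1) by have [] := nxtP _ (z_lt (s n)).
have s_inj : injective s.
  by move=> m n smn; apply: (increasing_inj s_incr); rewrite smn.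
have s_surj k : exists n, s n = k.
  apply: contrapT => /forallNP sk.
  have s_lt n : z (s n) < z k.
    rewrite lt_neqAle; apply/andP; split.
      by apply/eqP => /z_inj; exact: sk.
    elim: n => [|n IHn] /=.
      by have [_] := nxtP _ (lt_trans (x0_lt k) (z_lt k)); apply.
    have [_] := nxtP _ (z_lt (s n)); apply.
    by rewrite lt_neqAle IHn andbT; apply/eqP => /z_inj; exact: sk.
  have [N zN] := eventually_above z_lim (z_lt k).
  have [n Nsn] := injective_unbounded N s_inj.
  by have := lt_trans (zN _ Nsn) (s_lt n); rewrite ltxx.
have [g gK] := boolp.choice s_surj.
by exists s; split=> //; exists g => // n; apply: s_inj; rewrite gK.
Qed.

Lemma sorted_gap z (s : nat -> nat) n k : bijective s ->
  (forall m, z (s m) < z (s m.+1)) -> z k <= z (s n) \/ z (s n.+1) <= z k.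
Proof.
move=> [g sK gK] s_incr; rewrite -[k]gK.
by have [kn|nk] := leqP (g k) n; [left|right];
  exact: (increasing_leq (z := z \o s)).
Qed.

End Enumeration.

(** * Rearranging the series of charges *)

Section Rearrangement.
Context {R : realType}.
Variables (a : nat -> R) (s g : nat -> nat).
Hypothesis a_ge0 : forall k, 0 <= a k.
Hypothesis a_sum : series a @ \oo --> (1 : R).
Hypotheses (sK : cancel s g) (gK : cancel g s).

(** A rearranged partial sum becomes the mean of an indicator, so that such sums can be compared
    through pointwise inequalities. *)
Lemma has_mean_below N :
  has_mean a (fun k => (g k < N)%:R) (\sum_(l < N) a (s l)).
Proof.
have h l : (l < N)%N -> has_mean a (fun k => (k == s l)%:R * 1) (a (s l)).
  by move=> _; have := has_mean_delta a (s l) 1; rewrite mulr1.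
apply: has_mean_ext (has_mean_sum _ _ _ h) => k.
have [kN|Nk] := ltnP (g k) N.
  rewrite (bigD1 (Ordinal kN))//= gK eqxx mulr1 big1 ?addr0// => i /negP ik.
  by case: eqP => [k_si|]; rewrite ?mul0r//; case: ik; apply/eqP/val_inj; rewrite /= k_si sK.
rewrite big1// => i _; case: eqP => [k_si|]; last by rewrite mul0r.
by move: Nk; rewrite k_si sK leqNgt ltn_ord.
Qed.

End Rearrangement.
Arguments has_mean_below {R} a {s g}.

Lemma series_rearrangement (R : realType) (a : nat -> R) (s : nat -> nat) :
  (forall k, 0 <= a k) -> series a @ \oo --> (1 : R) -> bijective s ->
  series (a \o s) @ \oo --> (1 : R).
Proof.
move=> a_ge0 a_sum [g sK gK]; apply/cvgrPdist_le => e e_gt0.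
have [M _ aM] : \forall M \near \oo, 1 - e <= series a M.
  by apply: (cvgr_ge 1 a_sum); rewrite ltrBlDr ltrDl.
(* From this rank on, the first [N] values of [s] include every index below [M]. *)
exists (\max_(k < M) (g k).+1)%N => // N /= MN.
have hN := has_mean_below a sK gK N.
have hM := has_mean_below a (frefl id) (frefl id) M.
have mass : series (a \o s) N = \sum_(l < N) a (s l).
  by rewrite /series /= big_mkord.
have h1 : \sum_(l < N) a (s l) <= 1.
  by apply: has_mean_le hN (has_mean_cst 1 a_sum) => // k; rewrite lern1 leq_b1.
rewrite mass ger0_norm ?subr_ge0// lerBlDr -lerBlDl.
apply: le_trans (aM M (leqnn M)) _; rewrite /series /= big_mkord.
apply: has_mean_le hM hN => // k; rewrite ler_nat.
have [kM|//] := ltnP k M; rewrite lt0b.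
apply: leq_trans MN; exact: (@leq_bigmax _ (fun k : 'I_M => (g k).+1) (Ordinal kM)).
Qed.

(** * Completeness of the orthogonal system and the column sums *)

Section ColumnSum.
Context {R : realType}.
Variables (rho : R) (a z w c : nat -> R) (s : nat -> nat).
Hypothesis a_gt0 : forall i, 0 < a i.
Hypothesis a_sum : series a @ \oo --> (1 : R).
Hypothesis z_lt : forall i, `|z i| < rho.
Hypothesis s_bij : bijective s.
Hypothesis zw : forall n, z (s n) < w n < z (s n.+1).
Hypothesis c_gt0 : forall i, 0 < c i.
Hypothesis phi_mean : forall i, has_mean a (fun k => (z k - w i)^-1) 0.
Hypothesis phi_orth : forall i l,
  has_mean a (fun k => (z k - w i)^-1 * (z k - w l)^-1)
    (if i == l then (c i)^-1 else 0).

Let phi i k := (z k - w i)^-1.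
Let y n := z (s n).

Let y_incr n : y n < y n.+1.
Proof. by have /andP[] := zw n; exact: lt_trans. Qed.

Let w_incr n : w n < w n.+1.
Proof.
by have /andP[_] := zw n; have /andP[+ _] := zw n.+1 => h1 h2; exact: lt_trans h2 h1.
Qed.

Let y_lt_w n i : (n <= i)%N -> y n < w i.
Proof.
move=> ni; have /andP[+ _] := zw i; apply: le_lt_trans.
exact: (increasing_leq y_incr).
Qed.

Let w_lt_y n i : (i < n)%N -> w i < y n.
Proof.
move=> ni; have /andP[_ +] := zw i => /lt_le_trans; apply.
exact: (increasing_leq y_incr).
Qed.

Let y_neq_w n i : y n - w i != 0.
Proof.
have [ni|i_n] := leqP n i; first by rewrite lt_eqF// subr_lt0 y_lt_w.
by rewrite gt_eqF// subr_gt0 w_lt_y.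
Qed.

(* The product vanishes at all of the [N + 1] smallest points except the
   [j]-th one, and interlacing bounds it from below there and from above at
   the remaining points. *)
Let delta N j x := \prod_(i < N) ((x - y (bump j i)) / (x - w i)).

Let delta_expansion N j : exists b, forall k,
  delta N j (z k) = expansion phi N 1 b k.
Proof.
have [g sK gK] := s_bij.
have [b bE] := partial_fractions (fun i => y (bump j i)) N (increasing_inj w_incr).
exists b => k; rewrite /delta bE// => i iN.
by rewrite -subr_eq0 -[k]gK y_neq_w.
Qed.

(** Every factor is at least [1]: for [i < j] one has [y i < w i < y j], and for [i >= j] one has
    [y j < w i < y i.+1], where numerator and denominator are both negative. *)
Let delta_at N j : 1 <= delta N j (y j).
Proof.
apply: (big_ind (fun v => 1 <= v)) => // [u v u1 v1|i _].
  by rewrite (le_trans u1)// ler_peMr// (le_trans ler01).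
rewrite /bump; case: leqP => ij /=.
  rewrite add1n -[_ / _]divrNN !opprB ler_pdivlMr ?mul1r ?subr_gt0 ?y_lt_w//.
  by rewrite lerD2r ltW// w_lt_y.
rewrite add0n ler_pdivlMr ?mul1r ?subr_gt0 ?w_lt_y//.
by rewrite lerD2l lerN2 ltW// y_lt_w.
Qed.

Let delta_zero N j n : (j <= N)%N -> (n <= N)%N -> n != j -> delta N j (y n) = 0.
Proof.
move=> jN nN nj; have nb : bump j (unbump j n) = n by rewrite unbumpKcond (negbTE nj).
have ubN : (unbump j n < N)%N.
  by move: jN nN nj; rewrite /unbump; lia.
by rewrite /delta (bigD1 (Ordinal ubN))//= nb subrr mul0r mul0r.
Qed.

(** At a point beyond the [N + 1] smallest, the factors with [i >= j] are at most [1]. Only the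
    first [j] need a bound, with numerator below [2 * rho] and denominator at least [y j - w i];
    hence the independence of [N]. *)
Let bound j := \prod_(i < j) (2 * rho / (y j - w i)).

Let delta_bound N j n : (j <= N)%N -> (N < n)%N ->
  0 <= delta N j (y n) <= bound j.
Proof.
move=> jN Nn.
(* The bound is extended by factors [1] to a product of length [N], so that the comparison goes
   factor by factor. *)
rewrite /bound (big_ord_widen _ (fun i => 2 * rho / (y j - w i)) jN) big_mkcond.
rewrite /delta; apply/andP; split.
  apply: prodr_ge0 => i _; apply: divr_ge0.
    rewrite subr_ge0 (increasing_leq y_incr)//.
    by have := ltn_ord i; rewrite /bump; lia.
  by rewrite subr_ge0 ltW// w_lt_y// (ltn_trans _ Nn).
apply: ler_prod => i _.
have win : w i < y n by rewrite w_lt_y// (ltn_trans _ Nn).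
rewrite /bump; case: leqP => ij /=.
  rewrite add1n; have yin : y i.+1 <= y n.
    by rewrite (increasing_leq y_incr)// (leq_trans _ Nn)// ltnS ltnW.
  rewrite divr_ge0 ?subr_ge0 ?(ltW win)//=.
  by rewrite ler_pdivrMr ?mul1r ?subr_gt0// lerD2l lerN2 ltW// w_lt_y.
have yin : y i <= y n by rewrite (increasing_leq y_incr)//; apply/ltnW/(ltn_trans _ Nn).
rewrite add0n divr_ge0 ?subr_ge0 ?(ltW win)//=.
apply: ler_pM; rewrite ?subr_ge0// ?invr_ge0 ?subr_ge0 ?(ltW win)//.
  have := z_lt (s n); have := z_lt (s i); rewrite -/(y n) -/(y i) !ltr_norml.
  by lra.
rewrite lef_pV2 ?posrE ?subr_gt0 ?win ?(w_lt_y ij)// lerD2r.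
by rewrite (increasing_leq y_incr)// ltnW// (leq_ltn_trans jN).
Qed.

(** With [D = delta N j (y j) ^+ 2] and [B = bound j ^+ 2], Cauchy-Schwarz gives [D <= m * T] for
    the mean [m] of the square of [delta], and [m <= a (s j) * D + B * eps] with [eps] the charge of
    the remaining points. As [D >= 1] and [a (s j) * T <= 1], this yields
    [1 - a (s j) * T <= B * eps * T]; multiplying by [a (s j)] removes [T] on the right. *)
Lemma kernel_diag_lower j : exists C, forall N, (j <= N)%N ->
  1 - C * (1 - \sum_(l < N.+1) a (s l)) <= a (s j) * kernel_diag phi c N (s j).
Proof.
have [g sK gK] := s_bij.
have a_ge0 k : 0 <= a k by exact: ltW.
exists (bound j ^+ 2 / a (s j)) => N jN.
set eps := 1 - \sum_(l < N.+1) _; set T := kernel_diag _ _ _ _.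
have [b bE] := delta_expansion N j.
have h1 : 1 <= delta N j (y j) by exact: delta_at.
have hm := @expansion_meanM _ a phi c a_sum phi_mean phi_orth N 1 b 1 b.
set m := _ + _ in hm.
have {}hm : has_mean a (fun k => expansion phi N 1 b k ^+ 2) m.
  by apply: has_mean_ext hm => k; rewrite expr2.
have hT := kernel_cauchy_schwarz a_ge0 a_sum c_gt0 phi_mean phi_orth (s j) hm.
rewrite -bE -/(y j) -/T in hT.
have hbelow := has_mean_below a sK gK N.+1.
have hle := has_meanD (has_mean_delta a (s j) (delta N j (y j) ^+ 2))
  (has_meanZ (bound j ^+ 2) (has_meanB (has_mean_cst 1 a_sum) hbelow)).
have {hle}m_le : m <= a (s j) * delta N j (y j) ^+ 2 + bound j ^+ 2 * eps.
  (* Termwise there is equality at [s j], zero at the other [N] of the [N + 1] smallest points, and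
     at most [bound j ^+ 2] at the rest. *)
  apply: has_mean_le hm hle => // k; rewrite -bE -[k in delta N j (z k)]gK -/(y _).
  have [->|kj] := eqVneq k (s j).
    by rewrite sK mul1r ltnS jN subrr mulr0 addr0.
  have gkj : g k != j by apply: contra kj => /eqP <-; rewrite gK.
  rewrite mul0r add0r; have [kN|Nk] := ltnP (g k) N.+1.
    by rewrite delta_zero// subrr mulr0 expr0n.
  have /andP[d0 db] := delta_bound jN Nk.
  by rewrite subr0 mulr1 ler_pXn2r// nnegrE (le_trans d0).
have T1 : 1 <= T by exact: kernel_diag_ge1.
have aT : a (s j) * T <= 1 by exact: kernel_diag_le a_ge0 a_sum c_gt0 phi_mean phi_orth N _.
have e0 : 0 <= eps.
  by rewrite subr_ge0; apply: has_mean_le hbelow (has_mean_cst 1 a_sum) => // k;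
    rewrite lern1 leq_b1.
have aj := a_gt0 (s j).
have d2 : 1 <= delta N j (y j) ^+ 2 by rewrite expr_ge1// (le_trans ler01).
move: hT m_le d2; set D := delta _ _ _ ^+ 2; set B := bound j ^+ 2 => hT m_le d2.
have B0 : 0 <= B by exact: sqr_ge0.
rewrite lerBlDr -lerBlDl mulrAC ler_pdivlMr//.
have T0 : 0 < T by apply: lt_le_trans T1.
have : D <= (a (s j) * D + B * eps) * T by rewrite (le_trans hT)// ler_pM2r.
have Be : 0 <= B * eps by exact: mulr_ge0.
move: aT T0 aj Be d2; set x := a (s j); set E := B * eps => xT T0 x0 E0 D1 DT.
have DT' : D * (1 - x * T) <= E * T by lra.
have : 1 - x * T <= E * T.
  by apply: le_trans DT'; rewrite ler_peMl// subr_ge0.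
move=> /(ler_wpM2r (ltW x0)) /le_trans; apply.
by rewrite -mulrA [T * x]mulrC ler_piMr.
Qed.

(** Up to the constant [a j], the partial sums are squeezed between the lower bound just obtained
    and Bessel's upper bound [1]. *)
Lemma column_sum j : series (fun i => c i * a j * (z j - w i)^-1 ^+ 2) @ \oo -->
  1 - a j.
Proof.
have [g sK gK] := s_bij; rewrite -[j]gK; move: (g j) => {}j.
have a_ge0 k : 0 <= a k by exact: ltW.
have [C hC] := kernel_diag_lower j.
have eps0 : 1 - C * (1 - \sum_(l < N.+1) a (s l)) @[N --> \oo] --> (1 : R).
  have := series_rearrangement a_ge0 a_sum s_bij; rewrite -cvg_shiftS => s1.
  rewrite -[X in _ --> X]subr0 -[X in _ - X](mulr0 C) -[X in C * X](subrr 1).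
  apply: cvgB; first exact: cvg_cst.
  apply: cvgM; first exact: cvg_cst.
  apply: cvgB; first exact: cvg_cst.
  apply: cvg_trans s1; apply: near_eq_cvg; apply: nearW => N.
  by rewrite /series /= big_mkord.
rewrite (_ : series _ = fun N => a (s j) * kernel_diag phi c N (s j) - a (s j)); last first.
  apply/funext => N; rewrite /series /= big_mkord /kernel_diag mulrDr mulr1.
  rewrite addrC addKr mulr_sumr; apply: eq_bigr => i _; rewrite /phi; ring.
apply: cvgB; last exact: cvg_cst.
apply: (squeeze_cvgr (h := fun=> 1) _ eps0); last exact: cvg_cst.
exists j => // N /= jN.
by rewrite hC//= (kernel_diag_le a_ge0 a_sum c_gt0 phi_mean phi_orth).
Qed.

End ColumnSum.

(** Only the positive terms are bounded: applied to the distances from a point to all the [z k],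
    this allows the point to be one of them. *)
Lemma positive_lower_bound (R : realDomainType) (d : nat -> R) e N : 0 < e ->
  (forall k, (N <= k)%N -> 0 < d k -> e <= d k) ->
  exists2 r, 0 < r & forall k, 0 < d k -> r <= d k.
Proof.
elim: N e => [|N IHN] e e_gt0 dN; first by exists e => // k; exact: dN.
have [dN0|dN0] := ltP 0 (d N); last first.
  apply: (IHN e) => // k; rewrite leq_eqVlt => /predU1P[<-|]; last exact: dN.
  by rewrite ltNge dN0.
apply: (IHN (Num.min e (d N))); first by rewrite lt_min e_gt0.
move=> k; rewrite leq_eqVlt => /predU1P[<-|Nk] dk0; rewrite ge_min ?lexx ?orbT//.
by rewrite dN.
Qed.

(** * The unique equilibrium in a gap between neighbouring charges *)

Section Gap.
Context {R : realType}.
Variables (a z : nat -> R).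
Hypothesis a_gt0 : forall i, 0 < a i.
Hypothesis a_sum : series a @ \oo --> (1 : R).

Let a_ge0 i : 0 <= a i. Proof. exact: ltW. Qed.

Lemma force_has_mean x r : 0 < r -> (forall k, r <= `|x - z k|) ->
  exists m, has_mean a (fun k => (x - z k)^-1) m.
Proof.
move=> r0 xr; apply: (bounded_has_mean (c := r^-1)) => //; first exact: cvgP a_sum.
by move=> k; rewrite normfV lef_pV2// posrE (lt_le_trans r0).
Qed.

Lemma inverse_diff (x y t : R) : x != t -> y != t ->
  (x - t)^-1 - (y - t)^-1 = (y - x) * ((x - t)^-1 * (y - t)^-1).
Proof. by rewrite -!(subr_eq0 _ t) => xt yt; field; rewrite xt yt. Qed.

Lemma weight_le1 i : a i <= 1.
Proof.
have /(has_mean_ge_term i a_ge0) := has_mean_cst 1 a_sum.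
by rewrite mulr1; apply.
Qed.

Variables (i j : nat).
Hypothesis zij : z i < z j.
Hypothesis gap : forall k, z k <= z i \/ z j <= z k.

(** In the left half of the gap, each charge on the right contributes at least [- D] per unit of
    charge, and symmetrically. At distance [eps k] from its endpoint [z k], the charge [a k] alone
    exerts a force of size [D], which outweighs the opposite forces since the total charge is [1];
    [a k <= 1] keeps that point within the half gap. *)
Let D := 2 / (z j - z i).

Let D_gt0 : 0 < D. Proof. by rewrite divr_gt0// subr_gt0. Qed.

Let eps k := a k / D.

Let eps_gt0 k : 0 < eps k. Proof. exact: divr_gt0. Qed.

Let eps_le k : eps k <= (z j - z i) / 2.
Proof. by rewrite -[leRHS]invf_div -/D ler_pdivrMr// mulVf ?gt_eqF// weight_le1. Qed.

Let left_force m : has_mean a (fun k => (z i + eps i - z k)^-1) m -> 0 <= m.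
Proof.
set x := z i + eps i => hm; have e0 := eps_gt0 i; have el := eps_le i.
(* The minorant equals [(eps i)^-1] at [i] and [- D] elsewhere; its mean is [a i * D]. *)
have h := has_meanB (has_mean_delta a i ((eps i)^-1 + D)) (has_mean_cst D a_sum).
apply: (@le_trans _ _ (a i * ((eps i)^-1 + D) - D)).
  rewrite mulrDr {1}/eps invf_div mulrCA divff ?gt_eqF// mulr1 addrC addrA addNr add0r.
  by rewrite mulr_ge0// ltW.
apply: has_mean_le h hm => // k; have [->|ki] := eqVneq k i.
  by rewrite mul1r addrK /x addrC addKr.
rewrite mul0r add0r; have [zk|zk] := gap k.
  have x0 : 0 < x - z k by rewrite /x; lra.
  by rewrite (@le_trans _ _ 0)// ?oppr_le0 ?invr_ge0 ltW.
rewrite lerNl -invrN opprB /D -[leRHS]invf_div lef_pV2 ?posrE; rewrite /x; lra.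
Qed.

Let right_force m : has_mean a (fun k => (z j - eps j - z k)^-1) m -> m <= 0.
Proof.
set x := z j - eps j => hm; have e0 := eps_gt0 j; have el := eps_le j.
have h := has_meanB (has_mean_cst D a_sum) (has_mean_delta a j ((eps j)^-1 + D)).
apply: (@le_trans _ _ (D - a j * ((eps j)^-1 + D))); last first.
  rewrite mulrDr {1}/eps invf_div mulrCA divff ?gt_eqF// mulr1 opprD addrA subrr add0r.
  by rewrite oppr_le0 mulr_ge0// ltW.
apply: has_mean_le hm h => // k; have [->|kj] := eqVneq k j.
  by rewrite mul1r opprD addrCA subrr addr0 /x addrC addKr invrN.
rewrite mul0r subr0; have [zk|zk] := gap k; last first.
  have x0 : x - z k < 0 by rewrite /x; lra.
  by rewrite (@le_trans _ _ 0)// ?invr_le0 ltW.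
rewrite /D -[leRHS]invf_div lef_pV2 ?posrE; rewrite /x; lra.
Qed.

(** On the gap no [x - z k] changes sign, so every term of the force is strictly decreasing. *)
Lemma equilibrium_unique x y : z i < x < z j -> z i < y < z j ->
  has_mean a (fun k => (x - z k)^-1) 0 -> has_mean a (fun k => (y - z k)^-1) 0 ->
  x = y.
Proof.
wlog xy : x y / x < y => [H|] xij yij hx hy.
  by case: (ltgtP x y) => // xy; [exact: H|apply/esym/H].
have pos k : 0 < (x - z k)^-1 - (y - z k)^-1.
  have [zk|zk] := gap k.
    by rewrite subr_gt0 ltf_pV2 ?posrE; lra.
  by rewrite subr_gt0 -ltrN2 -!invrN !opprB ltf_pV2 ?posrE; lra.
have := has_mean_ge_term 0%N a_ge0 (fun k => ltW (pos k)) (has_meanB hx hy).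
by rewrite subrr leNgt mulr_gt0.
Qed.

(** Intermediate value theorem between the two points where the sign of the force is known. All
    charges are at distance at least [r] from the interval joining them, so the force is Lipschitz
    there with constant [r^-2]. *)
Lemma equilibrium_exists :
  exists2 x, z i < x < z j & has_mean a (fun k => (x - z k)^-1) 0.
Proof.
set x1 := z i + eps i; set x2 := z j - eps j.
have [e1 e2 l1 l2] := And4 (eps_gt0 i) (eps_gt0 j) (eps_le i) (eps_le j).
have x12 : x1 <= x2 by rewrite /x1 /x2; lra.
pose r := Num.min (eps i) (eps j).
have r0 : 0 < r by rewrite lt_min e1.
have far x k : x \in `[x1, x2] -> r <= `|x - z k|.
  rewrite in_itv /= => /andP[xx1 xx2]; rewrite /r ge_min.
  have [zk|zk] := gap k; [apply/orP; left|apply/orP; right].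
    by rewrite ler_normr; apply/orP; left; move: xx1; rewrite /x1; lra.
  by rewrite ler_normr; apply/orP; right; move: xx2; rewrite /x2; lra.
pose F x := limn (series (fun k => a k * (x - z k)^-1)).
have hF x : x \in `[x1, x2] -> has_mean a (fun k => (x - z k)^-1) (F x).
  move=> xI; have [m hm] := force_has_mean r0 (fun k => far x k xI).
  by rewrite /F (cvg_lim _ hm).
have lip x y : x \in `[x1, x2] -> y \in `[x1, x2] ->
    `|F x - F y| <= `|x - y| * r^-2.
  move=> xI yI; have hxy := has_meanB (hF _ xI) (hF _ yI).
  have bnd k : `|(x - z k)^-1 - (y - z k)^-1| <= `|x - y| * r^-2.
    have [fx fy] := (far x k xI, far y k yI).
    have nz t : r <= `|t - z k| -> t != z k.
      by move=> /(lt_le_trans r0); rewrite normr_gt0 subr_eq0.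
    rewrite inverse_diff ?nz// normrM distrC ler_wpM2l// normrM !normfV -exprVn expr2.
    by rewrite ler_pM// lef_pV2 ?posrE ?(lt_le_trans r0).
  rewrite ler_norml; apply/andP; split.
    apply: has_mean_le (has_mean_cst _ a_sum) hxy => // k.
    by have := bnd k; rewrite ler_norml => /andP[].
  apply: has_mean_le hxy (has_mean_cst _ a_sum) => // k.
  by have := bnd k; rewrite ler_norml => /andP[].
have cont : {within `[x1, x2], continuous F}.
  apply/subspace_continuousP => x /= xI; apply/cvgrPdist_lt => e e0.
  have er : 0 < e * r ^+ 2 by rewrite mulr_gt0// exprn_gt0.
  near=> y; have yI : y \in `[x1, x2] by near: y; exact: withinT.
  apply: le_lt_trans (lip _ _ xI yI) _.
  rewrite ltr_pdivrMr ?exprn_gt0//; near: y.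
  by apply: cvg_within; exact: nbhsx_ballx.
have F1 : 0 <= F x1 by apply/left_force/hF; rewrite in_itv /= lexx.
have F2 : F x2 <= 0 by apply/right_force/hF; rewrite in_itv /= lexx x12.
have [|x xI Fx] := @IVT _ F x1 x2 0 x12 cont.
  by rewrite ge_min le_max F1 F2 orbT.
exists x; last by rewrite -Fx; exact: hF.
by move: xI; rewrite in_itv /= /x1 /x2; lra.
Unshelve. all: by end_near. Qed.

End Gap.

(** * Convex functions of one real variable *)

Section Convex.
Context {R : realType}.
Variable g : R -> R.
Hypothesis g_convex : forall t x y, 0 <= t <= 1 ->
  g (t * x + (1 - t) * y) <= t * g x + (1 - t) * g y.

Lemma convex_three_points u x v : u < x -> x < v ->
  (g x - g u) / (x - u) <= (g v - g x) / (v - x).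
Proof.
move=> ux xv; have uv := lt_trans ux xv.
pose t := (v - x) / (v - u).
have t01 : 0 <= t <= 1.
  rewrite divr_ge0 ?subr_ge0 ?(ltW xv) ?(ltW uv)//=.
  rewrite ler_pdivrMr ?subr_gt0// mul1r lerD2l lerN2.
  exact: ltW.
have vu0 : v - u != 0 by rewrite subr_eq0 gt_eqF.
have xE : t * u + (1 - t) * v = x by rewrite /t; field.
have := g_convex u v t01; rewrite xE => gx.
have h : (v - u) * g x <= (v - x) * g u + (x - u) * g v.
  have -> : (v - x) * g u + (x - u) * g v = (v - u) * (t * g u + (1 - t) * g v).
    by rewrite /t; field.
  by rewrite ler_pM2l// subr_gt0.
rewrite ler_pdivrMr ?subr_gt0// mulrAC ler_pdivlMr ?subr_gt0//.
by lra.
Qed.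

Lemma convex_subgradient x : exists m, forall y, g x + m * (y - x) <= g y.
Proof.
(* The subgradient is the supremum of the slopes of chords to the left of [x]; any chord to the
   right bounds it from above. *)
pose slopes := [set s | exists2 u, u < x & s = (g x - g u) / (x - u)].
have slopes_ub v : x < v -> ubound slopes ((g v - g x) / (v - x)).
  by move=> xv _ [u ux ->]; exact: convex_three_points.
have slopes0 : slopes !=set0.
  by exists ((g x - g (x - 1)) / (x - (x - 1))); exists (x - 1) => //; lra.
have slopes_bnd : has_ubound slopes.
  by exists ((g (x + 1) - g x) / (x + 1 - x)); apply: slopes_ub; lra.
exists (sup slopes) => y; case: (ltgtP y x) => [yx|xy|->].
- have : (g x - g y) / (x - y) <= sup slopes by apply: ub_le_sup => //; exists y.
  by rewrite ler_pdivrMr ?subr_gt0//; lra.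
- have : sup slopes <= (g y - g x) / (y - x).
    by apply: ge_sup => //; exact: slopes_ub.
  by rewrite ler_pdivlMr ?subr_gt0//; lra.
- by rewrite subrr mulr0 addr0.
Qed.

(** The values at the endpoints bound [g] from above, and a subgradient at [0] bounds it from below.
    Boundedness makes the row means of [g] converge. *)
Lemma convex_bounded r : exists C, forall x, `|x| <= r -> `|g x| <= C.
Proof.
have [m gm] := convex_subgradient 0.
exists (`|g 0| + `|m| * r + `|g r| + `|g (- r)|) => x xr.
have mx : `|m * x| <= `|m| * r by rewrite normrM ler_wpM2l.
have r0 : 0 <= r by exact: le_trans xr.
move: (gm x); rewrite subr0 => gx.
have up : g x <= `|g r| + `|g (- r)|.
  move: r0; rewrite le_eqVlt => /predU1P[r0|r0].
    have -> : x = r by apply/eqP; rewrite -r0 -normr_le0 r0.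
    by rewrite (le_trans (ler_norm _))// lerDl.
  pose t := (r - x) / (2 * r).
  have t01 : 0 <= t <= 1.
    move: xr; rewrite ler_norml => /andP[x1 x2].
    rewrite divr_ge0 ?mulr_ge0 ?(ltW r0) ?subr_ge0//= ler_pdivrMr; lra.
  have xE : t * (- r) + (1 - t) * r = x by rewrite /t; field; rewrite gt_eqF.
  have := g_convex (- r) r t01; rewrite xE => /le_trans; apply.
  have /andP[t0 t1] := t01; rewrite addrC; apply: lerD.
    rewrite (le_trans (ler_norm _))// normrM ler_piMl// ger0_norm; lra.
  by rewrite (le_trans (ler_norm _))// normrM ler_piMl// ger0_norm.
have mr : 0 <= `|m| * r by rewrite mulr_ge0.
have := ler_norm (- g 0); have := ler_norm (- (m * x)); rewrite !normrN.
have := normr_ge0 (g 0); have := normr_ge0 (g r); have := normr_ge0 (g (- r)).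
by rewrite ler_norml; lra.
Qed.

(** Otherwise there are points [u], [x], [v] in increasing order with [g] negative, positive and
    negative. A subgradient at [x] then forces [g v] or [g u] to be positive, according to its
    sign. *)
Lemma convex_eventual_sign r : exists2 x, x < r &
  (forall y, x <= y < r -> 0 <= g y) \/ (forall y, x <= y < r -> g y <= 0).
Proof.
apply: contrapT => /forall2NP no_sign.
have neg x : x < r -> exists2 y, x <= y < r & g y < 0.
  have [//|/not_orP[/existsNP[y /not_implyP[xy /negP gy]] _]] := no_sign x.
  by exists y => //; rewrite ltNge.
have pos x : x < r -> exists2 y, x <= y < r & 0 < g y.
  have [//|/not_orP[_ /existsNP[y /not_implyP[xy /negP gy]]]] := no_sign x.
  by exists y => //; rewrite ltNge.
have [u /andP[_ ur] gu] : exists2 y, r - 1 <= y < r & g y < 0 by apply: neg; lra.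
have [x /andP[ux xr] gx] := pos u ur.
have [v /andP[xv vr] gv] := neg x xr.
have [m gm] := convex_subgradient x.
have [m0|m0] := leP 0 m.
  have : 0 <= m * (v - x) by rewrite mulr_ge0// subr_ge0.
  by have := gm v; lra.
have : 0 <= m * (u - x) by rewrite mulr_le0// ?subr_le0// ltW.
by have := gm u; lra.
Qed.

(** The mean of the subgradient inequality at the barycentre [m]; the linear term averages to
    zero. *)
Lemma convex_jensen (p x : nat -> R) r m n : (forall k, 0 <= p k) ->
  series p @ \oo --> (1 : R) -> (forall k, `|x k| <= r) ->
  has_mean p x m -> has_mean p (g \o x) n -> g m <= n.
Proof.
move=> p_ge0 p_sum xr xm gn; have [d gd] := convex_subgradient m.
have h := has_meanD (has_mean_cst (g m) p_sum)
  (has_meanZ d (has_meanB xm (has_mean_cst m p_sum))).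
by have := has_mean_le p_ge0 (fun k => gd (x k)) h gn; rewrite subrr mulr0 addr0.
Qed.

End Convex.

(** * Exchanging summations for sequences of eventually constant sign *)

Section EventualSign.
Context {R : realType}.
Implicit Type u : nat -> R.

Definition eventually_signed u := exists N,
  (forall k, (N <= k)%N -> 0 <= u k) \/ (forall k, (N <= k)%N -> u k <= 0).

Lemma sum_ge_split u N K : (forall k, (N <= k)%N -> 0 <= u k) -> (N <= K)%N ->
  \sum_(k < N) u k <= \sum_(k < K) u k.
Proof.
move=> u0 NK; rewrite -!(big_mkord xpredT) (big_cat_nat (n := N) _ NK)//= lerDl.
by rewrite big_nat_cond sumr_ge0// => k /andP[/andP[Nk _] _]; exact: u0.
Qed.

Lemma sum_le_split u N K : (forall k, (N <= k)%N -> u k <= 0) -> (N <= K)%N ->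
  \sum_(k < K) u k <= \sum_(k < N) u k.
Proof.
move=> u0 NK; rewrite -lerN2 -!sumrN.
by apply: (sum_ge_split (u := fun k => - u k)) => // k /u0; rewrite oppr_ge0.
Qed.

Lemma eventually_signed_cvg u : eventually_signed u ->
  cvgn (fun n => (\sum_(0 <= k < n) (u k)%:E)%E).
Proof.
move=> [N sgn].
suff : cvgn (fun n => (\sum_(k < n + N) u k)%:E).
  move=> /cvg_ex[l ul]; apply/cvg_ex; exists l.
  rewrite -(cvg_shiftn N); apply: cvg_trans ul.
  by apply: near_eq_cvg; apply: nearW => n /=; rewrite sumEFin big_mkord.
case: sgn => sgn.
  apply: ereal_nondecreasing_is_cvgn => m n mn; rewrite lee_fin.
  apply: sum_ge_split; last by rewrite leq_add2r.
  by move=> k mk; apply: sgn; rewrite (leq_trans _ mk)// leq_addl.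
apply: ereal_nonincreasing_is_cvgn => m n mn; rewrite lee_fin.
apply: sum_le_split; last by rewrite leq_add2r.
by move=> k mk; apply: sgn; rewrite (leq_trans _ mk)// leq_addl.
Qed.

(** Summing the first [n] rows gives [\sum_(j < n) m j] as the mean of [v] with weights [sg n],
    which increase to [d]. The sign of the tail of [v] replaces dominated convergence: only finite
    sums over [k] pass to the limit in [n]. *)
Lemma majorization (S : nat -> nat -> R) (d u v : nat -> R) :
  (forall j k, 0 <= S j k) ->
  (forall k, series (fun j => S j k) @ \oo --> d k) ->
  (forall j, exists2 m, has_mean (S j) v m & u j <= m) ->
  eventually_signed u -> eventually_signed v ->
  [/\ cvgn (fun n => (\sum_(0 <= j < n) (u j)%:E)%E),
      cvgn (fun n => (\sum_(0 <= k < n) (d k * v k)%:E)%E) &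
      (\sum_(0 <= j <oo) (u j)%:E <= \sum_(0 <= k <oo) (d k * v k)%:E)%E].
Proof.
move=> S0 Sd uv u_sgn [N v_sgn].
have [m mv um] : exists2 m : nat -> R, (forall j, has_mean (S j) v (m j)) &
    forall j, u j <= m j.
  have uv' j : exists m, has_mean (S j) v m /\ u j <= m.
    by have [m ? ?] := uv j; exists m.
  by have [m mP] := boolp.choice uv'; exists m => j; have [] := mP j.
pose sg n k := \sum_(j < n) S j k.
have sg_le n k : sg n k <= d k.
  have nd : nondecreasing_seq (series (fun j => S j k)).
    by apply: nondecreasing_series => j _ _.
  have := nondecreasing_cvgn_le nd (cvgP _ (Sd k)) n; rewrite (cvg_lim _ (Sd k))//.
  by rewrite /series /= big_mkord.
have sg_ge0 n k : 0 <= sg n k by apply: sumr_ge0.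
have d_ge0 k : 0 <= d k by exact: le_trans (sg_le 0%N k).
have sg_cvg (M : nat) :
    \sum_(k < M) sg n k * v k @[n --> \oo] --> \sum_(k < M) d k * v k.
  elim: M => [|M IHM].
    rewrite big_ord0; under eq_fun do rewrite big_ord0; exact: cvg_cst.
  rewrite big_ord_recr /=; under eq_fun do rewrite big_ord_recr /=.
  apply: cvgD => //; apply: cvgM; last exact: cvg_cst.
  apply: cvg_trans (Sd M); apply: near_eq_cvg; apply: nearW => n.
  by rewrite /series /= big_mkord.
have mix n : has_mean (fun k => sg n k) v (\sum_(j < n) m j).
  rewrite /has_mean (_ : series _ = fun K => \sum_(j < n) series (fun k => S j k * v k) K).
    elim: n => [|n IHn].
      by rewrite big_ord0; under eq_fun do rewrite big_ord0; exact: cvg_cst.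
    rewrite big_ord_recr /=; under eq_fun do rewrite big_ord_recr /=.
    by apply: cvgD => //; exact: mv.
  apply/funext => K; rewrite /series /= exchange_big /=.
  by apply: eq_bigr => k _; rewrite /sg mulr_suml.
have u_le n : \sum_(j < n) u j <= \sum_(j < n) m j by exact: ler_sum.
have u_cvg := eventually_signed_cvg u_sgn.
have v_cvg : cvgn (fun n => (\sum_(0 <= k < n) (d k * v k)%:E)%E).
  apply: eventually_signed_cvg; exists N; case: v_sgn => sgn; [left|right] => k /sgn vk.
    exact: mulr_ge0.
  exact: mulr_ge0_le0.
split=> //; pose B M := \sum_(k < M) d k * v k.
have BE M : (\sum_(0 <= k < M) (d k * v k)%:E)%E = (B M)%:E.
  by rewrite sumEFin big_mkord.
have lim_le (X : nat -> R) (x : R) : (forall n, \sum_(j < n) u j <= X n) ->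
    X @ \oo --> x -> (\sum_(0 <= j <oo) (u j)%:E <= x%:E)%E.
  move=> uX Xx; have XE : (X n)%:E @[n --> \oo] --> x%:E.
    by apply: cvg_EFin; [exact: nearW|exact: Xx].
  rewrite -(cvg_lim _ XE)//; apply: lee_lim => //; first exact: cvgP XE.
  by apply: nearW => n; rewrite sumEFin big_mkord lee_fin.
(* If the tail of [v] is nonpositive, truncating at any [M >= N] increases the means; [n] tends to
   infinity first, then [M]. *)
case: v_sgn => v_sgn; last first.
  apply: lime_ge => //; exists N => // M /= NM; rewrite BE.
  apply: lim_le (sg_cvg M) => n; apply: le_trans (u_le n) _.
  apply: cvgr_to_le (mix n) _; exists M => // K /= MK; rewrite /series /= big_mkord.
  apply: (sum_le_split (u := fun k => sg n k * v k)) => // k Mk.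
  by rewrite mulr_ge0_le0// v_sgn// (leq_trans NM).
set L := (X in (_ <= X)%E); have LB M : (N <= M)%N -> ((B M)%:E <= L)%E.
  move=> NM; apply: lime_ge => //; exists M => // K /= MK; rewrite BE lee_fin.
  apply: (sum_ge_split (u := fun k => d k * v k)) => // k Mk.
  by rewrite mulr_ge0// v_sgn// (leq_trans NM).
(* With a nonnegative tail, [L] dominates the finite sum [B N], so it is not [-oo]; the value [+oo]
   is trivial. *)
move: LB; case: L => [r| |] LB; last by have := LB N (leqnn N).
  (* For finite [L = r], the first [N] terms keep the weights [sg n] and the tail is replaced by the
     whole tail [r - B N] with weights [d]. *)
  apply: (lim_le (fun n => \sum_(k < N) sg n k * v k + (r - B N))) => [n|]; last first.
    rewrite [X in _ --> X](_ : r = B N + (r - B N)); last by rewrite addrC subrK.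
    apply: cvgD; first exact: sg_cvg.
    exact: cvg_cst.
  apply: le_trans (u_le n) _; apply: cvgr_to_le (mix n) _; exists N => // K /= NK.
  have := LB K NK; rewrite lee_fin => BK.
  have tail : \sum_(k < N) (d k - sg n k) * v k <= \sum_(k < K) (d k - sg n k) * v k.
    apply: (sum_ge_split (u := fun k => (d k - sg n k) * v k)) => // k Nk.
    by rewrite mulr_ge0 ?subr_ge0// v_sgn.
  have tailE P : \sum_(k < P) (d k - sg n k) * v k = B P - \sum_(k < P) sg n k * v k.
    by rewrite -sumrB; apply: eq_bigr => k _; rewrite mulrBl.
  by rewrite /series /= big_mkord; move: tail BK; rewrite !tailE; lra.
by rewrite leey.
Qed.

End EventualSign.

(** * Means of complex sequences *)

Section ComplexMean.
Context {R : realType}.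
Implicit Types (a : nat -> R) (g h : nat -> R[i]) (m p c : R[i]) (r : R).

Lemma norm_real_complex r : `|r%:C| = `|r|%:C :> R[i].
Proof. by rewrite normc_def /= expr0n addr0 sqrtr_sqr. Qed.

Lemma cvg_real_complex (u : nat -> R) (l : R) : u @ \oo --> l ->
  (fun n => (u n)%:C : R[i]) @ \oo --> (l%:C : R[i]).
Proof.
move=> ul; apply/cvgrPdist_lt => e e0.
(* In the order of [R[i]], a positive element is real, so [e] is its own real part. *)
have eE : (complex.Re e)%:C = e by rewrite RRe_real// gtr0_real.
have e0' : 0 < complex.Re e by rewrite -ltcR eE.
near=> k; rewrite -rmorphB norm_real_complex -eE ltcR.
by near: k; exact: cvgr_dist_lt.
Unshelve. all: by end_near. Qed.

Lemma norm_Re_le c r : `|c| <= r%:C -> `|complex.Re c| <= r.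
Proof. by move=> cr; rewrite -lecR (le_trans (normc_ge_Re c)). Qed.

Lemma norm_Im_le c r : `|c| <= r%:C -> `|complex.Im c| <= r.
Proof.
rewrite normc_def lecR; apply: le_trans.
by rewrite -sqrtr_sqr ler_wsqrtr// lerDr sqr_ge0.
Qed.

Lemma norm_ReIm_le c r : `|complex.Re c| <= r -> `|complex.Im c| <= r ->
  `|c| <= (2 * r)%:C.
Proof.
move=> re im; rewrite {1}[c]complexE (le_trans (ler_normD _ _))// normrM.
have -> : `|'i%C : R[i]| = 1 by rewrite normc_def /= expr0n expr1n add0r sqrtr1.
by rewrite mul1r !norm_real_complex -rmorphD lecR mulr2n mulrDl mul1r lerD.
Qed.

(** The weights stay real, so the results on real means apply to each component. *)
Definition has_cmean a g m :=
  has_mean a (fun k => complex.Re (g k)) (complex.Re m) /\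
  has_mean a (fun k => complex.Im (g k)) (complex.Im m).

Lemma has_cmean_cvg a g m : has_cmean a g m ->
  series (fun k => (a k)%:C * g k) @ \oo --> m.
Proof.
move=> [re im]; rewrite [m]complexE.
rewrite (_ : series _ = fun n : nat =>
    (series (fun k => a k * complex.Re (g k)) n)%:C +
    'i%C * (series (fun k => a k * complex.Im (g k)) n)%:C).
  apply: cvgD; first exact: cvg_real_complex.
  by apply: cvgM; [exact: cvg_cst|exact: cvg_real_complex].
apply/funext => N; rewrite /series /= !rmorph_sum mulr_sumr -big_split.
apply: eq_bigr => k _ /=; rewrite {1}[g k]complexE !rmorphM /= mulrDr; congr (_ + _).
by rewrite mulrCA.
Qed.

Lemma has_cmean_ext a g h m : g =1 h -> has_cmean a g m -> has_cmean a h m.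
Proof. by move=> /funext ->. Qed.

Lemma has_cmeanB a g h m p : has_cmean a g m -> has_cmean a h p ->
  has_cmean a (fun k => g k - h k) (m - p).
Proof.
move=> [re im] [re' im']; split; rewrite raddfB.
  by apply: has_mean_ext (has_meanB re re') => k; rewrite raddfB.
by apply: has_mean_ext (has_meanB im im') => k; rewrite raddfB.
Qed.

Lemma has_cmeanZ a g m c : has_cmean a g m -> has_cmean a (fun k => c * g k) (c * m).
Proof.
case: c m => [u v] [s t] [/= re im]; split => /=.
  by apply: has_mean_ext (has_meanB (has_meanZ u re) (has_meanZ v im)) => k /=;
    case: (g k).
by apply: has_mean_ext (has_meanD (has_meanZ u im) (has_meanZ v re)) => k /=;
  case: (g k).
Qed.

Variable a : nat -> R.
Hypothesis a_ge0 : forall k, 0 <= a k.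
Hypothesis a_sum : series a @ \oo --> (1 : R).

Lemma bounded_has_cmean g r : (forall k, `|g k| <= r%:C) ->
  exists m, has_cmean a g m.
Proof.
move=> gr; have a_cvg := cvgP _ a_sum.
have [p hp] := bounded_has_mean a_ge0 a_cvg (fun k => norm_Re_le (gr k)).
have [q hq] := bounded_has_mean a_ge0 a_cvg (fun k => norm_Im_le (gr k)).
by exists (p +i* q).
Qed.

(** The two components are bounded separately, whence the factor [2]; any constant serves the
    estimates below. *)
Lemma has_cmean_norm_le g m r : (forall k, `|g k| <= r%:C) -> has_cmean a g m ->
  `|m| <= (2 * r)%:C.
Proof.
move=> gr [re im].
have bound (h : nat -> R) (p : R) : has_mean a h p -> (forall k, `|h k| <= r) -> `|p| <= r.
  move=> hp hr; rewrite ler_norml; apply/andP; split.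
    apply: has_mean_le (has_mean_cst _ a_sum) hp => // k.
    by have := hr k; rewrite ler_norml => /andP[].
  apply: has_mean_le hp (has_mean_cst _ a_sum) => // k.
  by have := hr k; rewrite ler_norml => /andP[].
by apply: norm_ReIm_le; [apply: bound re _ => k; exact: norm_Re_le
                        |apply: bound im _ => k; exact: norm_Im_le].
Qed.

End ComplexMean.

(** * Holomorphy of the force away from the charges *)

Section ComplexForce.
Context {R : realType}.
Variables (rho : R) (a z : nat -> R).
Hypothesis a_gt0 : forall i, 0 < a i.
Hypothesis a_sum : series a @ \oo --> (1 : R).
Hypothesis z_lim : z @ \oo --> rho.

Let a_ge0 i : 0 <= a i. Proof. exact: ltW. Qed.

Let f := total_force a z.

Definition away (x : R[i]) (r : R) := forall k, r%:C <= `|x - (z k)%:C|.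

Lemma away_neq x r k : 0 < r -> away x r -> x - (z k)%:C != 0.
Proof.
by move=> r0 xr; rewrite -normr_gt0 (lt_le_trans _ (xr k))// (ltcR 0).
Qed.

Lemma inv_norm_le (u : R[i]) r : 0 < r -> r%:C <= `|u| -> `|u^-1| <= (r^-1)%:C.
Proof.
move=> r0 ru; have r0C : 0 < r%:C :> R[i] by rewrite (ltcR 0).
by rewrite normfV fmorphV/= lef_pV2// posrE// (lt_le_trans r0C).
Qed.

Lemma total_force_cmean x r : 0 < r -> away x r ->
  has_cmean a (fun k => (x - (z k)%:C)^-1) (f x) /\ cvgn (series (force a z x)).
Proof.
move=> r0 xr; have [|m hm] := bounded_has_cmean a_ge0 a_sum
    (g := fun k => (x - (z k)%:C)^-1) (r := r^-1).
  by move=> k; exact: inv_norm_le.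
have fm := has_cmean_cvg hm.
have -> : f x = m by exact: cvg_lim fm.
split; [exact: hm|exact: cvgP fm].
Qed.

Lemma away_near x y r : away x r -> `|x - y| < (r / 2)%:C -> away y (r / 2).
Proof.
move=> xr xy k; have := xr k; have := ler_normD (x - y) (y - (z k)%:C).
rewrite addrA subrK => /[swap] /le_trans /[apply].
rewrite {1}(splitr r) rmorphD => h.
by rewrite -(lerD2l ((r / 2)%:C)) (le_trans h)// lerD2r ltW.
Qed.

(** Charges of large index are near [rho], hence at distance at least half of [rho - t] from [x],
    where [t] is the modulus of [x]. Finitely many others remain. *)
Lemma disk_separated x : disk rho x ->
  exists2 r, 0 < r & forall k, x != (z k)%:C -> r%:C <= `|x - (z k)%:C|.
Proof.
move=> x_rho.
have nE (u : R[i]) : (complex.Re `|u|)%:C = `|u| by rewrite RRe_real// normr_real.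
set t := complex.Re `|x|.
have t_rho : t < rho by move: x_rho; rewrite /disk /= -nE ltcR.
have [N zN] := eventually_above (x := (t + rho) / 2) z_lim (midf_lt t_rho).2.
pose d k := complex.Re `|x - (z k)%:C|.
have dN k : (N <= k)%N -> 0 < d k -> (rho - t) / 2 <= d k.
  move=> Nk _; rewrite -lecR nE distrC; apply: le_trans (lerB_dist _ _).
  rewrite norm_real_complex -[`|x|]nE -rmorphB lecR.
  have := zN k Nk; have := ler_norm (z k); rewrite -/t; lra.
have [|r r0 rd] := positive_lower_bound _ dN; first by lra.
exists r => // k xk; rewrite -nE lecR rd// -ltcR nE normr_gt0.
by rewrite subr_eq0.
Qed.

(** The derivative [m] is the termwise one. The difference between [m] and the difference quotient
    has the terms [- h * q k ^+ 2 / (h + x - z k)], so it is bounded by [K] times the modulus of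
    [h]. *)
Lemma total_force_derivable x r : 0 < r -> away x r -> derivable f x 1.
Proof.
move=> r0 xr.
have r20 : 0 < r / 2 by rewrite divr_gt0.
pose q k := (x - (z k)%:C)^-1.
have [|m hm] := bounded_has_cmean a_ge0 a_sum (g := fun k => - (q k * q k))
    (r := r^-1 * r^-1).
  by move=> k; rewrite normrN normrM rmorphM/= ler_pM ?inv_norm_le.
have [fx _] := total_force_cmean r0 xr.
apply/cvg_ex; exists m => /=; apply/cvgrPdist_lt => e e0.
have eE : (complex.Re e)%:C = e by rewrite RRe_real// gtr0_real.
have e0' : 0 < complex.Re e by rewrite -ltcR eE.
pose K := 2 * (r^-1 * r^-1 * (r / 2)^-1).
have K0 : 0 < K by rewrite !mulr_gt0 ?invr_gt0.
near=> h.
have h0 : h != 0 by near: h; exact: nbhs_dnbhs_neq.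
have hr : `|h| < (r / 2)%:C.
  by near: h; apply: dnbhs0_lt; rewrite (ltcR 0).
have hK : `|h| < (complex.Re e / K)%:C.
  by near: h; apply: dnbhs0_lt; rewrite (ltcR 0) divr_gt0.
have xhr : away (h + x) (r / 2).
  by apply: away_near xr _; rewrite opprD addrCA subrr addr0 normrN.
have [fh _] := total_force_cmean r20 xhr.
rewrite [h *: 1]mulr1.
have hd := has_cmeanB hm (has_cmeanZ h^-1 (has_cmeanB fh fx)).
have {}hd : has_cmean a (fun k => - h * (q k * q k * (h + x - (z k)%:C)^-1))
    (m - h^-1 *: (f (h + x) - f x)).
  apply: has_cmean_ext hd => k; rewrite /q.
  have := away_neq k r20 xhr; have := away_neq k r0 xr => xz xhz.
  by field; rewrite h0 xz xhz.
have eta : (complex.Re `|h|)%:C = `|h| by rewrite RRe_real// normr_real.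
apply: le_lt_trans (has_cmean_norm_le (r := complex.Re `|h| * (r^-1 * r^-1 * (r / 2)^-1))
    a_ge0 a_sum _ hd) _ => [k|].
  rewrite normrM normrN !rmorphM/= eta ler_wpM2l// !normrM.
  by rewrite ler_pM ?mulr_ge0// ?inv_norm_le// ler_pM ?inv_norm_le.
rewrite mulrCA -/K -eE ltcR -ltr_pdivlMr//.
by rewrite -ltcR eta.
Unshelve. all: by end_near. Qed.

Lemma total_force_holomorphic x r : 0 < r -> away x r -> holomorphic_at f x.
Proof.
move=> r0 xr; rewrite /holomorphic_at.
have r20 : 0 < r / 2 by rewrite divr_gt0.
near=> y; apply: (total_force_derivable r20); apply: away_near xr _.
by near: y; apply: nbhsx_ballx; rewrite (ltcR 0).
Unshelve. all: by end_near. Qed.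
End ComplexForce.

(** * Behaviour of the force at the charges *)

Section Poles.
Context {R : realType}.
Variables (rho : R) (a z : nat -> R).
Hypothesis a_gt0 : forall i, 0 < a i.
Hypothesis a_sum : series a @ \oo --> (1 : R).
Hypothesis z_inj : injective z.
Hypothesis z_lt : forall i, `|z i| < rho.
Hypothesis z_lim : z @ \oo --> rho.

Let a_ge0 i : 0 <= a i. Proof. exact: ltW. Qed.

Let f := total_force a z.

Lemma has_cmean_delta i (c : R[i]) :
  has_cmean a (fun k => (k == i)%:R * c) ((a i)%:C * c).
Proof.
case: c => u v; split => /=; rewrite mul0r ?subr0 ?addr0.
  apply: has_mean_ext (has_mean_delta a i u) => k.
  by case: eqP => _ /=; rewrite ?mul1r ?mul0r ?subr0.
apply: has_mean_ext (has_mean_delta a i v) => k.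
by case: eqP => _ /=; rewrite ?mul1r ?mul0r ?addr0.
Qed.

(** Near [z i] all the other charges stay at distance at least [r / 2], so [f] differs from its
    [i]-th term by a bounded amount. *)
Lemma total_force_near_pole i : exists s B, [/\ 0 < s, 0 < B &
  forall u, u != (z i)%:C -> `|u - (z i)%:C| < s%:C ->
    (exists2 r, 0 < r & away z u r) /\
    (a i)%:C / `|u - (z i)%:C| <= `|f u| + B%:C].
Proof.
have zi_rho : disk rho (z i)%:C by rewrite /disk /= norm_real_complex ltcR.
have [r r0 rz] := disk_separated z_lim zi_rho.
have r20 : 0 < r / 2 by rewrite divr_gt0.
exists (r / 2), (2 * (r / 2)^-1); split=> // [|u ui u_near].
  by rewrite mulr_gt0// invr_gt0.
have far k : k != i -> (r / 2)%:C <= `|u - (z k)%:C|.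
  move=> ki; have zik : (z i)%:C != (z k)%:C :> R[i].
    by apply: contra ki => /eqP/complexI/z_inj ->.
  have := rz k zik; have := ler_normD ((z i)%:C - u) (u - (z k)%:C).
  rewrite addrA subrK => /[swap] /le_trans /[apply].
  rewrite {1}(splitr r) rmorphD => h.
  by rewrite -(lerD2l ((r / 2)%:C)) (le_trans h)// lerD2r distrC ltW.
have uE : (complex.Re `|u - (z i)%:C|)%:C = `|u - (z i)%:C|.
  by rewrite RRe_real// normr_real.
have d0 : 0 < complex.Re `|u - (z i)%:C|.
  by rewrite -ltcR uE normr_gt0 subr_eq0.
have [s s0 us] : exists2 s, 0 < s & away z u s.
  exists (Num.min (r / 2) (complex.Re `|u - (z i)%:C|)).
    by rewrite lt_min r20.
  move=> k; have [->|ki] := eqVneq k i; first by rewrite -uE lecR ge_min lexx orbT.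
  by apply: le_trans (far k ki); rewrite lecR ge_min lexx.
split; first by exists s.
have [fu _] := total_force_cmean a_gt0 a_sum s0 us.
have hd := has_cmeanB (has_cmean_delta i (u - (z i)%:C)^-1) fu.
have := has_cmean_norm_le (r := (r / 2)^-1) a_ge0 a_sum _ hd.
move=> /(_ _)/le_trans h.
rewrite -lerBlDl; apply: le_trans (h _ _ _).
- rewrite -[X in X - _](_ : `|(a i)%:C / (u - (z i)%:C)| = _); last first.
    by rewrite normrM normfV norm_real_complex ger0_norm.
  exact: lerB_dist.
- move=> k; have [->|ki] := eqVneq k i.
    by rewrite mul1r subrr normr0 (lecR 0) invr_ge0 ltW.
  by rewrite mul0r sub0r normrN inv_norm_le// far.
- exact: lexx.
Qed.

Lemma total_force_pole i : pole f (z i)%:C.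
Proof.
have [s [B [s0 B0 fB]]] := total_force_near_pole i.
have sC : 0 < s%:C :> R[i] by rewrite (ltcR 0).
have near_i (e : R[i]) : 0 < e -> \forall u \near (z i)%:C^', `|u - (z i)%:C| < e.
  move=> e0; near=> u; rewrite distrC; near: u.
  by apply: cvg_within; exact: nbhsx_ballx.
split.
  near=> u; have [||[r r0 ur] _] := fB u; first by near: u; exact: nbhs_dnbhs_neq.
    by near: u; exact: near_i.
  exact: total_force_holomorphic r0 ur.
move=> P [M [M_real MP]].
have ME : (complex.Re `|M|)%:C = `|M| by rewrite RRe_real// normr_real.
set t := complex.Re `|M| in ME.
have t0 : 0 <= t by rewrite -ler0c ME.
have tB : 0 < t + B + 1 by lra.
suff : \forall u \near (z i)%:C^', M < `|f u| by apply: filterS => u; exact: MP.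
near=> u.
have ui : u != (z i)%:C by near: u; exact: nbhs_dnbhs_neq.
have [|_ h] := fB u ui; first by near: u; exact: near_i.
have ud : 0 < `|u - (z i)%:C| by rewrite normr_gt0 subr_eq0.
(* This close to [z i], the single term exceeds [t + B + 1], so [f u] exceeds [t], the modulus of
   [M], in modulus. *)
have us : `|u - (z i)%:C| < (a i / (t + B + 1))%:C.
  by near: u; apply: near_i; rewrite (ltcR 0) divr_gt0.
apply: le_lt_trans (real_ler_norm M_real) _; rewrite -ME -(ltrD2r B%:C).
apply: lt_le_trans h; rewrite ltr_pdivlMr// -rmorphD.
apply: (@lt_le_trans _ _ ((t + B + 1)%:C * (a i / (t + B + 1))%:C)); last first.
  by rewrite -rmorphM/= mulrC divfK// gt_eqF.
by apply: ltr_pM => //; rewrite ?ltcR ?ler0c; lra.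
Unshelve. all: by end_near. Qed.

(** Being total, [f] has some value at [z i] too, so a charge must be excluded as a zero.
    Differentiability there would bound [f] nearby, against the lower bound near the pole. *)
Lemma total_force_not_holomorphic i : ~ holomorphic_at f (z i)%:C.
Proof.
move=> /nbhs_singleton /cvg_ex[/= L fL].
have [s [B [s0 B0 fB]]] := total_force_near_pole i.
have sC : 0 < s%:C :> R[i] by rewrite (ltcR 0).
(* With derivative [L], the modulus of [f] near [z i] is at most that of [f (z i)] plus that of [L]
   plus [1]; [C] exceeds this bound plus [B]. *)
pose C : R[i] := `|f (z i)%:C| + `|L| + 1 + B%:C + 1.
have B0C : 0 < B%:C :> R[i] by rewrite (ltcR 0).
have C0 : 0 < C by rewrite ltr_wpDl// !addr_ge0// ltW.
have aC : 0 < (a i)%:C :> R[i] by rewrite (ltcR 0).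
suff : \forall h \near (0 : R[i])^', False by move=> /filter_ex[].
near=> h.
have h0 : h != 0 by near: h; exact: nbhs_dnbhs_neq.
have hd : 0 < `|h| by rewrite normr_gt0.
have h1 : `|h| < 1 by near: h; exact: dnbhs0_lt.
have hs : `|h| < s%:C by near: h; exact: dnbhs0_lt.
have hC : `|h| < (a i)%:C / C by near: h; apply: dnbhs0_lt; exact: divr_gt0.
have hL : `|L - h^-1 * (f (h * 1 + (z i)%:C) - f (z i)%:C)| < 1.
  by near: h; move/cvgrPdist_lt : fL; exact.
rewrite mulr1 in hL.
have [| |_] := fB (h + (z i)%:C); rewrite ?addrK//.
  by rewrite -subr_eq0 addrK.
rewrite ler_pdivrMr// => /le_lt_trans no_gap.
suff /no_gap : (`|f (h + (z i)%:C)| + B%:C) * `|h| < (a i)%:C by rewrite ltxx.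
have fu : `|f (h + (z i)%:C)| <= `|f (z i)%:C| + (`|L| + 1).
  set q := h^-1 * _ in hL.
  have -> : f (h + (z i)%:C) = f (z i)%:C + h * q by rewrite /q mulVKf// [RHS]addrC subrK.
  apply: le_trans (ler_normD _ _) _; rewrite lerD2l normrM.
  have qL : `|q| <= `|L| + 1.
    have -> : q = L - (L - q) by rewrite subKr.
    by apply: le_trans (ler_normB _ _) _; rewrite lerD2l ltW.
  exact: le_trans (ler_piMl (normr_ge0 q) (ltW h1)) qL.
apply: (@lt_le_trans _ _ (C * ((a i)%:C / C))); last by rewrite mulrC divfK// gt_eqF.
have fB0 : 0 <= `|f (h + (z i)%:C)| + B%:C by exact: addr_ge0 (ltW B0C).
have fC : `|f (h + (z i)%:C)| + B%:C < C.
  have le_fC : `|f (h + (z i)%:C)| + B%:C <= `|f (z i)%:C| + (`|L| + 1) + B%:C.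
    by rewrite lerD2r.
  by apply: le_lt_trans le_fC _; rewrite /C !addrA ltrDl.
exact: ltr_pM fB0 (normr_ge0 h) fC hC.
Unshelve. all: by end_near. Qed.

Lemma total_force_real x m : has_mean a (fun k => (x - z k)^-1) m ->
  total_force a z x%:C = m%:C.
Proof.
move=> /cvg_real_complex xm; apply: cvg_lim => //; apply: cvg_trans xm.
apply: near_eq_cvg; apply: nearW => n; rewrite /series /= rmorph_sum.
by apply: eq_bigr => k _; rewrite /force rmorphM fmorphV/= rmorphB.
Qed.

End Poles.

(** * The real zeros and the redistribution matrix *)

Section RealZeros.
Context {R : realType}.
Variables (rho : R) (a z w : nat -> R) (s : nat -> nat).
Hypothesis a_gt0 : forall i, 0 < a i.
Hypothesis a_sum : series a @ \oo --> (1 : R).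
Hypothesis z_inj : injective z.
Hypothesis z_lt : forall i, `|z i| < rho.
Hypothesis z_lim : z @ \oo --> rho.
Hypothesis s_bij : bijective s.
Hypothesis zw : forall n, z (s n) < w n < z (s n.+1).
Hypothesis w_mean : forall n, has_mean a (fun k => (w n - z k)^-1) 0.

Let a_ge0 i : 0 <= a i. Proof. exact: ltW. Qed.

Let z_lt_rho i : z i < rho. Proof. exact: ltr_normlW. Qed.

Let y_incr n : z (s n) < z (s n.+1).
Proof. by have /andP[] := zw n; exact: lt_trans. Qed.

Lemma equilibria_increasing n : w n < w n.+1.
Proof.
by have /andP[_] := zw n; have /andP[+ _] := zw n.+1 => h1 h2; exact: lt_trans h2 h1.
Qed.

Lemma equilibrium_norm_lt n : `|w n| < rho.
Proof.
have /andP[h1 h2] := zw n; have := z_lt (s n); have := z_lt (s n.+1).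
by rewrite !ltr_norml; lra.
Qed.

Lemma equilibrium_neq n k : w n != z k.
Proof.
have /andP[h1 h2] := zw n; have [zk|zk] := sorted_gap n k s_bij y_incr.
  by rewrite gt_eqF// (le_lt_trans zk).
by rewrite lt_eqF// (lt_le_trans h2).
Qed.

Lemma equilibria_cvg : w @ \oo --> rho.
Proof.
have [g sK gK] := s_bij; apply/cvgrPdist_lt => e e0.
have [|N zN] := eventually_above (x := rho - e) z_lim; first by lra.
exists (g N) => // n /= gn; have := equilibrium_norm_lt n.
have /andP[zwn _] := zw n; have := zN N (leqnn N).
have : z N <= z (s n) by rewrite -[N in z N]gK (increasing_leq y_incr).
by rewrite ltr_norml => ? ? /andP[_ ?]; rewrite gtr0_norm; lra.
Qed.

Lemma real_separated x : `|x| < rho -> (forall k, x != z k) ->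
  exists2 r, 0 < r & forall k, r <= `|x - z k|.
Proof.
move=> x_rho xz; have xC : disk rho x%:C by rewrite /disk /= norm_real_complex ltcR.
have [r r0 rz] := disk_separated z_lim xC; exists r => // k.
rewrite -lecR -norm_real_complex rmorphB; apply: rz.
by apply: contra (xz k) => /eqP/complexI ->.
Qed.

Lemma real_away x r : (forall k, r <= `|x - z k|) -> away z x%:C r.
Proof. by move=> xr k; rewrite -rmorphB norm_real_complex lecR. Qed.

Lemma equilibrium_between x : `|x| < rho -> (forall k, x != z k) ->
  has_mean a (fun k => (x - z k)^-1) 0 -> exists m, z (s m) < x < z (s m.+1).
Proof.
move=> x_rho xz hx; have [g sK gK] := s_bij.
have ex : exists n, ~~ (z (s n) < x).
  have [N zN] := eventually_above z_lim (ltr_normlW x_rho).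
  by exists (g N); rewrite gK -leNgt ltW// zN.
have [n zn n_min] := ex_minnP ex.
case: n zn n_min => [|m] zn n_min; last first.
  exists m; apply/andP; split; last by rewrite lt_neqAle xz leNgt.
  by apply/negPn/negP => /n_min; rewrite ltnn.
(* The least index is [0] here, so [x] lies left of all charges and every term of the force is
   negative: no equilibrium. *)
have neg k : 0 < -1 * (x - z k)^-1.
  rewrite mulN1r oppr_gt0 invr_lt0 subr_lt0 lt_neqAle xz.
  by rewrite -leNgt in zn; rewrite (le_trans zn)// -[k]gK (increasing_leq y_incr).
have := has_mean_ge_term 0%N a_ge0 (fun k => ltW (neg k)) (has_meanZ (-1) hx).
by rewrite mulr0 leNgt mulr_gt0.
Qed.

(** A real zero is not a charge, since [f] is not holomorphic there; it therefore lies in a gap and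
    is the equilibrium of that gap. *)
Lemma real_zerosE : real_zeros (disk rho) (total_force a z) = range w.
Proof.
apply/seteqP; split => [x [x_disk [x_holo fx]]|_ [n _ <-]].
  have x_rho : `|x| < rho by move: x_disk; rewrite /disk /= norm_real_complex ltcR.
  have xz k : x != z k.
    by apply: contra_notN (total_force_not_holomorphic a_gt0 a_sum z_inj z_lt z_lim (i := k))
      => /eqP <-.
  have [r r0 xr] := real_separated x_rho xz.
  have [m hm] := force_has_mean a_gt0 a_sum r0 xr.
  move: (total_force_real hm); rewrite fx => /complexI m0.
  rewrite -m0 in hm; have [n xn] := equilibrium_between x_rho xz hm.
  exists n => //.
  exact: (equilibrium_unique a_gt0 (fun k => sorted_gap n k s_bij y_incr)
    (zw n) xn (w_mean n) hm).
have [r r0 wr] := real_separated (equilibrium_norm_lt n) (equilibrium_neq n).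
split; first by rewrite /disk /= norm_real_complex ltcR equilibrium_norm_lt.
split; last by rewrite (total_force_real (w_mean n)).
exact: total_force_holomorphic a_gt0 a_sum _ _ r0 (real_away wr).
Qed.

Lemma equilibria_bij : set_bij [set: nat] (range w) w.
Proof.
split; first by move=> n _; exists n.
  by move=> m n _ _; exact: increasing_inj equilibria_increasing _ _.
by move=> x [n _ <-]; exists n.
Qed.

Lemma equilibria_infinite : infinite_set (range w).
Proof.
move=> fin; apply: infinite_nat; rewrite -(preimage_range w).
by apply: finite_preimage fin => m n _ _; exact: increasing_inj equilibria_increasing _ _.
Qed.

Lemma equilibria_discrete x : x < rho -> ~ limit_point (range w) x.
Proof.
move=> x_rho /limit_point_cluster_eventually /(cvg_cluster equilibria_cvg).
by move=> /(@norm_hausdorff _ R) rx; move: x_rho; rewrite rx ltxx.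
Qed.

Lemma redistribution : exists S : nat -> nat -> R, forall i j,
  [/\ 0 <= S i j, series (fun k => S i k) @ \oo --> (1 : R),
      series (fun l => S l j) @ \oo --> 1 - a j &
      series (fun k => S i k * z k) @ \oo --> w i].
Proof.
pose phi i k := (z k - w i)^-1.
have phi_mean i : has_mean a (phi i) 0.
  have := has_meanZ (-1) (w_mean i); rewrite mulr0; apply: has_mean_ext => k.
  by rewrite mulN1r -invrN opprB.
have zw0 i k : z k - w i != 0 by rewrite subr_eq0 eq_sym equilibrium_neq.
have norms i : exists q, has_mean a (fun k => phi i k * phi i k) q.
  have [r r0 wr] := real_separated (equilibrium_norm_lt i) (equilibrium_neq i).
  apply: (bounded_has_mean (c := r^-1 * r^-1)) => //; first exact: cvgP a_sum.
  move=> k; have rk := lt_le_trans r0 (wr k).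
  have iv : `|w i - z k|^-1 <= r^-1 by rewrite lef_pV2// posrE.
  by rewrite normrM !normfV distrC; apply: ler_pM.
have [q q_mean] := boolp.choice norms.
have q_gt0 i : 0 < q i.
  have pos k : 0 < phi i k * phi i k by rewrite -expr2 exprn_even_gt0//= invr_eq0 zw0.
  apply: lt_le_trans (has_mean_ge_term 0%N a_ge0 (fun k => ltW (pos k)) (q_mean i)).
  exact: mulr_gt0.
pose c i := (q i)^-1.
have c_gt0 i : 0 < c i by rewrite invr_gt0.
have phi_orth i l : has_mean a (fun k => phi i k * phi l k)
    (if i == l then (c i)^-1 else 0).
  have [<-|il] := eqVneq i l; first by rewrite invrK.
  have wil : w i - w l != 0.
    rewrite subr_eq0; apply: contra il => /eqP.
    by move=> /(increasing_inj equilibria_increasing) ->.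
  (* The product [phi i k * phi l k] is [(phi i k - phi l k) / (w i - w l)]. *)
  have := has_meanZ (w i - w l)^-1 (has_meanB (phi_mean i) (phi_mean l)).
  rewrite subrr mulr0; apply: has_mean_ext => k.
  by rewrite /phi; field; rewrite wil !zw0.
have row i : has_mean a (fun k => c i * (phi i k * phi i k)) 1.
  by have := has_meanZ (c i) (q_mean i); rewrite mulVf// gt_eqF.
exists (fun i j => c i * a j * phi i j ^+ 2) => i j; split.
- by rewrite mulr_ge0 ?sqr_ge0// mulr_ge0 ?ltW.
- have := row i; rewrite /has_mean; apply: cvg_trans; apply: near_eq_cvg.
  by apply: nearW => n; apply: eq_bigr => k _; ring.
- exact: column_sum a_gt0 a_sum z_lt s_bij zw c_gt0 phi_mean phi_orth j.
(* Writing [z k = w i + (z k - w i)], the second summand cancels one factor [phi i k] and leaves a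
   multiple of the vanishing mean of [phi i]. *)
- have := has_meanD (has_meanZ (w i) (row i)) (has_meanZ (c i) (phi_mean i)).
  rewrite mulr1 mulr0 addr0 /has_mean; apply: cvg_trans; apply: near_eq_cvg.
  apply: nearW => n; apply: eq_bigr => k _; rewrite /phi.
  by field; rewrite zw0.
Qed.

End RealZeros.

(** [Rcomplex R] views [R[i]] as a real vector space. The map from [t] to [lambda * t%:C + mu] is
    affine over the reals, which reduces the inequality to a convex function of a real variable. *)
Lemma convex_function_line (R : realType) (Phi : R[i] -> R) (lambda mu : R[i]) :
  convex_function (E := Rcomplex R) setT Phi -> forall t x y : R, 0 <= t <= 1 ->
  Phi (lambda * (t * x + (1 - t) * y)%:C + mu) <=
  t * Phi (lambda * x%:C + mu) + (1 - t) * Phi (lambda * y%:C + mu).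
Proof.
move=> Phi_convex t x y /andP[t0 t1].
have := Phi_convex (Itv01 t0 t1) (lambda * x%:C + mu) (lambda * y%:C + mu).
rewrite !in_setT => /(_ isT isT); congr (Phi _ <= _).
case: lambda mu => [l1 l2] [m1 m2]; rewrite /conv /= /unstable.onem.
by apply/eqP; rewrite eq_complex; apply/andP; split; apply/eqP; rewrite /=; ring.
Qed.

Theorem theorem6 (R : realType) (rho : R) (a z : nat -> R)
    (rho_gt0 : 0 < rho)
    (a_gt0 : forall i, 0 < a i)
    (a_sum : series a @ \oo --> (1 : R))
    (z_inj : injective z)
    (z_lt : forall i, `|z i| < rho)
    (z_lim : z @ \oo --> rho) :
  let f := total_force a z in
  let W := real_zeros (disk rho) f in
  [/\ forall x : R[i], disk rho x -> (forall i, x <> (z i)%:C) ->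
        cvgn (series (force a z x)),
      meromorphic_on (disk rho) f,
      infinite_set W,
      forall x : R, disk rho x%:C -> ~ limit_point W x &
      exists w : nat -> R,
        [/\ set_bij [set: nat] W w,
            interlace z w,
            exists S : nat -> nat -> R, forall i j,
              [/\ 0 <= S i j,
                  series (fun k => S i k) @ \oo --> (1 : R),
                  series (fun l => S l j) @ \oo --> 1 - a j &
                  series (fun k => S i k * z k) @ \oo --> w i] &
            forall (lambda mu : R[i]) (Phi : R[i] -> R),
              lambda != 0 ->
              convex_function (E := Rcomplex R) setT Phi ->
              let lhs j := (Phi (lambda * (w j)%:C + mu))%:E in
              let rhs i := ((1 - a i) * Phi (lambda * (z i)%:C + mu))%:E in
              [/\ cvgn (fun n => \sum_(0 <= j < n) lhs j)%E,
                  cvgn (fun n => \sum_(0 <= i < n) rhs i)%E &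
                  (\sum_(0 <= j <oo) lhs j <= \sum_(0 <= i <oo) rhs i)%E]]].
Proof.
move=> f W.
have z_lt_rho i : z i < rho by exact: ltr_normlW.
have [s [s_bij s_incr]] := sorting_bijection z_inj z_lt_rho z_lim.
have equilibria n : exists x, z (s n) < x < z (s n.+1) /\
    has_mean a (fun k => (x - z k)^-1) 0.
  have [x ? ?] := equilibrium_exists a_gt0 a_sum (s_incr n)
    (fun k => sorted_gap n k s_bij s_incr).
  by exists x.
have {equilibria}[w w_spec] := boolp.choice equilibria.
have zw n : z (s n) < w n < z (s n.+1) by have [] := w_spec n.
have w_mean n : has_mean a (fun k => (w n - z k)^-1) 0 by have [] := w_spec n.
have WE : W = range w := real_zerosE a_gt0 a_sum z_inj z_lt z_lim s_bij zw w_mean.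
have separated (x : R[i]) : disk rho x -> (forall i, x <> (z i)%:C) ->
    exists2 r, 0 < r & away z x r.
  move=> x_rho xz; have [r r0 xr] := disk_separated z_lim x_rho.
  by exists r => // k; apply: xr; apply/eqP; exact: xz.
split.
- move=> x x_rho xz; have [r r0 xr] := separated x x_rho xz.
  by have [] := total_force_cmean a_gt0 a_sum r0 xr.
- move=> x x_rho; have [[i ->]|xz] := pselect (exists i, x = (z i)%:C).
    by right; exact: total_force_pole a_gt0 a_sum z_inj z_lt z_lim i.
  have [|r r0 xr] := separated x x_rho; first by move=> i xi; apply: xz; exists i.
  by left; exact: total_force_holomorphic a_gt0 a_sum _ _ r0 xr.
- by rewrite WE; exact: equilibria_infinite zw.
- move=> x; rewrite /disk /= norm_real_complex ltcR WE => /ltr_normlW.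
  exact: equilibria_discrete z_lt z_lim s_bij zw x.
exists w; split.
- by rewrite WE; exact: equilibria_bij zw.
(* The equilibria are indexed by their gaps, so [w] is already increasing and only [z] needs
   sorting. *)
- by exists s, id; split=> //; exists id.
- exact: redistribution a_gt0 a_sum z_lt z_lim s_bij zw w_mean.
move=> lambda mu Phi _ Phi_convex.
have g_convex := convex_function_line lambda mu Phi_convex.
have [S SP] := redistribution a_gt0 a_sum z_lt z_lim s_bij zw w_mean.
pose g t := Phi (lambda * t%:C + mu).
(* Both [z] and [w] tend to [rho] from below, so both sides of the inequality eventually have terms
   of constant sign. *)
have sgn (u : nat -> R) : u @ \oo --> rho -> (forall n, u n < rho) ->
    eventually_signed (g \o u).
  move=> u_lim u_lt; have [x0 x0_lt g_sgn] := convex_eventual_sign (g := g) g_convex rho.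
  have [N uN] := eventually_above u_lim x0_lt; exists N.
  by case: g_sgn => g_sgn; [left|right] => k /uN uk; apply: g_sgn; rewrite u_lt ltW.
have w_lt n : w n < rho by exact: ltr_normlW (equilibrium_norm_lt z_lt zw n).
apply: (majorization (S := S) (u := g \o w) (v := g \o z)).
- by move=> j k; have [] := SP j k.
- by move=> k; have [] := SP 0%N k.
- move=> j; have Sj k : 0 <= S j k by have [] := SP j k.
  have [_ S1 _ Sw] := SP j 0%N.
  have z_le k : `|z k| <= rho by exact: ltW.
  have [C gC] := convex_bounded (g := g) g_convex rho.
  have [m gm] := bounded_has_mean Sj (cvgP _ S1) (fun k => gC _ (z_le k)).
  exists m => //; exact: (convex_jensen (g := g) g_convex Sj S1 z_le Sw gm).
- by apply: sgn => //; exact: equilibria_cvg z_lt z_lim s_bij zw.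
- exact: sgn.
Qed.
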